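(* The Hausdorff dimension $\delta(3)$ of the limit set of the Hecke triangle group $\Gamma_3$ satisfies $$0.75065<\delta(3)<0.75322 .$$
   Context: For $w>2$, $\Gamma_w\subset\mathrm{PSL}_2(\mathbb{R})$ is the (discrete) group generated by the Möbius transformations $S\colon z\mapsto -1/z$ and $T_w\colon z\mapsto z+w$ of the upper half-plane $\mathbb{H}^2$. Its limit set is the set of accumulation points (in the Riemann sphere) of all orbits of $\Gamma_w$ on $\mathbb{H}^2$, and $\delta(w)$ is the Hausdorff dimension of this limit set. *)

(* Defs.v *)
From HB Require Import structures.
From mathcomp Require Import all_boot all_order all_algebra.
From mathcomp Require Import all_classical all_reals all_analysis.
From mathcomp Require Import complex ring.

Set Implicit Arguments.
Unset Strict Implicit.
Unset Printing Implicit Defensive.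

Import Order.TTheory GRing.Theory Num.Theory.
Import numFieldNormedType.Exports.
Import ComplexField.Normc.

Local Open Scope classical_set_scope.
Local Open Scope complex_scope.
Local Open Scope ring_scope.

Definition riemann_sphere (R : realType) : Type := option R[i].

HB.instance Definition _ (R : realType) := Choice.on (riemann_sphere R).

(* The chordal metric: the Euclidean distance in R^3 between the stereographic
   preimages on the unit sphere; [None] is the point at infinity. *)
Definition chordal (R : realType) (p q : riemann_sphere R) : R :=
  match p, q with
  | Some z, Some z' =>
      2 * normc (z - z')
      / (Num.sqrt (1 + normc z ^+ 2) * Num.sqrt (1 + normc z' ^+ 2))
  | Some z, None | None, Some z => 2 / Num.sqrt (1 + normc z ^+ 2)
  | None, None => 0
  end.

Section chordal_metric.
Variable R : realType.
Implicit Types (z : R[i]) (p q r : riemann_sphere R).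

(* Homogeneous coordinates. *)
Let hc1 p : R[i] := if p is Some z then z else 1.
Let hc2 p : R[i] := if p is Some _ then 1 else 0.
Let sqn p : R := normc (hc1 p) ^+ 2 + normc (hc2 p) ^+ 2.
Let det p q := hc1 p * hc2 q - hc1 q * hc2 p.
Let dot p q := hc1 p * (hc1 q)^*%C + hc2 p * (hc2 q)^*%C.

Let normc_sqrt z : normc z = Num.sqrt ((complex.Re z) ^+ 2 + (complex.Im z) ^+ 2).
Proof. by case: z. Qed.

Let normc_ge0' z : 0 <= normc z.
Proof. by rewrite normc_sqrt sqrtr_ge0. Qed.

Let sqr_normc' z : normc z ^+ 2 = (complex.Re z) ^+ 2 + (complex.Im z) ^+ 2.
Proof. by rewrite normc_sqrt sqr_sqrtr// addr_ge0// sqr_ge0. Qed.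

Let sqn_gt0 p : 0 < sqn p.
Proof.
case: p => [z|]; rewrite /sqn /= ?normc1 ?normc0 ?expr1n ?expr0n /= ?addr0 //.
by rewrite ltr_wpDl ?sqr_ge0.
Qed.

Let chordalE p q :
  chordal p q = 2 * normc (det p q) / (Num.sqrt (sqn p) * Num.sqrt (sqn q)).
Proof.
have sqnS z : sqn (Some z) = 1 + normc z ^+ 2.
  by rewrite /sqn [normc (hc2 _)]normc1 expr1n addrC.
have sqnN : sqn None = 1.
  by rewrite /sqn [normc (hc1 _)]normc1 [normc (hc2 _)]normc0 expr1n expr0n addr0.
case: p => [z|]; case: q => [z'|]; rewrite ?sqnS ?sqnN ?sqrtr1.
- have -> : det (Some z) (Some z') = z - z' by rewrite /det /=; ring.
  by [].
- have -> : det (Some z) None = -1 by rewrite /det /=; ring.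
  by rewrite normcN normc1 !mulr1.
- have -> : det None (Some z') = 1 by rewrite /det /=; ring.
  by rewrite normc1 mulr1 mul1r.
- have -> : det None None = 0 by rewrite /det /=; ring.
  by rewrite normc0 mulr0 mul0r.
Qed.

Let lagrange p q r :
  det p r * (sqn q)%:C = det p q * dot r q + det q r * dot p q.
Proof.
have -> : (sqn q)%:C = dot q q.
  rewrite /sqn /dot !sqr_normc'.
  case: (hc1 q) => a b; case: (hc2 q) => c d /=.
  by apply/eqP; rewrite eq_complex /=; apply/andP; split; apply/eqP; ring.
by rewrite /dot /det; ring.
Qed.

Let cauchy_schwarz p q : normc (dot p q) <= Num.sqrt (sqn p) * Num.sqrt (sqn q).
Proof.
rewrite -sqrtrM ?(ltW (sqn_gt0 _))// normc_sqrt ler_sqrt; last first.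
  by rewrite mulr_ge0 ?ltW ?sqn_gt0.
rewrite /sqn /dot !sqr_normc'.
case: (hc1 p) (hc2 p) (hc1 q) (hc2 q) => a b [c d] [e f] [g h] /=.
set lhs := (X in X <= _); set rhs := (X in _ <= X).
have : 0 <= (a * g - b * h - (e * c - f * d)) ^+ 2
          + (a * h + b * g - (e * d + f * c)) ^+ 2.
  by rewrite addr_ge0 ?sqr_ge0.
rewrite -[lhs <= rhs]subr_ge0; congr (_ <= _).
by rewrite /rhs /lhs; ring.
Qed.

Lemma chordalxx p : chordal p p = 0.
Proof. by rewrite chordalE /det subrr normc0 mulr0 mul0r. Qed.

Lemma chordal_positivity p q : chordal p q = 0 -> p = q.
Proof.
have s0 z : Num.sqrt (1 + normc z ^+ 2) != 0.
  by rewrite gt_eqF// sqrtr_gt0 ltr_wpDr ?sqr_ge0.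
case: p => [z|]; case: q => [z'|] //= /eqP.
- rewrite mulf_eq0 invr_eq0 !mulf_eq0 !(negbTE (s0 _)) pnatr_eq0 /= orbF.
  by move=> /eqP /eq0_normc /eqP; rewrite subr_eq0 => /eqP ->.
- by rewrite mulf_eq0 invr_eq0 (negbTE (s0 _)) pnatr_eq0.
- by rewrite mulf_eq0 invr_eq0 (negbTE (s0 _)) pnatr_eq0.
Qed.

Lemma chordal_sym p q : chordal p q = chordal q p.
Proof.
rewrite !chordalE [Num.sqrt (sqn p) * _]mulrC.
by congr (_ * _ / _); rewrite -normcN /det opprB.
Qed.

Lemma chordal_triangle q p r : chordal p r <= chordal p q + chordal q r.
Proof.
have s0 x : 0 < Num.sqrt (sqn x) by rewrite sqrtr_gt0.
have H : normc (det p r) * sqn q <=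
    normc (det p q) * (Num.sqrt (sqn r) * Num.sqrt (sqn q))
    + normc (det q r) * (Num.sqrt (sqn p) * Num.sqrt (sqn q)).
  have <- : normc (det p r * (sqn q)%:C) = normc (det p r) * sqn q.
    rewrite normcM; congr (_ * _).
    by rewrite normc_sqrt /= expr0n addr0 sqrtr_sqr gtr0_norm.
  rewrite lagrange (le_trans (le_normcD _ _))// !normcM.
  by rewrite lerD// ler_wpM2l.
have sq : sqn q = Num.sqrt (sqn q) ^+ 2 by rewrite sqr_sqrtr// ltW.
rewrite !chordalE; move: H; rewrite {1}sq.
move: (s0 p) (s0 q) (s0 r).
move: (Num.sqrt (sqn p)) (Num.sqrt (sqn q)) (Num.sqrt (sqn r)) => a b c.
move: (normc (det p r)) (normc (det p q)) (normc (det q r)) => x y z a0 b0 c0 H.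
have -> : 2 * y / (a * b) + 2 * z / (b * c)
    = 2 * (y * (c * b) + z * (a * b)) / b ^+ 2 / (a * c).
  by field; rewrite !gt_eqF.
rewrite ler_pM2r ?invr_gt0 ?mulr_gt0// ler_pdivlMr ?exprn_gt0//.
by rewrite -mulrA ler_pM2l.
Qed.

End chordal_metric.

HB.instance Definition _ (R : realType) :=
  isMetric.Build R (riemann_sphere R) (@chordalxx R) (@chordal_positivity R)
    (@chordal_sym R) (@chordal_triangle R).

Definition upper_half_plane (R : realType) : Type := {z : R[i] | 0 < complex.Im z}.

Lemma moebiusS_subproof (R : realType) (z : upper_half_plane R) :
  0 < complex.Im (- (val z)^-1).
Proof.
case: z => -[a b] /= b0.
have n0 : 0 < a ^+ 2 + b ^+ 2 by rewrite ltr_wpDl ?sqr_ge0 ?exprn_gt0.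
by rewrite opprK divr_gt0.
Qed.

Definition moebiusS (R : realType) (z : upper_half_plane R) :
  upper_half_plane R := exist _ (- (val z)^-1) (moebiusS_subproof z).

Lemma moebiusT_subproof (R : realType) (w : R) (z : upper_half_plane R) :
  0 < complex.Im (val z + w%:C).
Proof. by case: z => -[a b] /= b0; rewrite addr0. Qed.

Definition moebiusT (R : realType) (w : R) (z : upper_half_plane R) :
  upper_half_plane R := exist _ (val z + w%:C) (moebiusT_subproof w z).

Definition transformation_group (T : Type) (G : set (T -> T)) : Prop :=
  [/\ G idfun,
      forall f g, G f -> G g -> G (f \o g) &
      forall f g, G f -> cancel f g -> cancel g f -> G g].

(* PSL_2(R) acts faithfully on the upper half-plane, so its subgroups are given
   here as groups of transformations of the upper half-plane. *)
Definition hecke_group (R : realType) (w : R) :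
    set (upper_half_plane R -> upper_half_plane R) :=
  smallest (@transformation_group _) [set @moebiusS R; moebiusT w].

Definition hecke_orbit (R : realType) (w : R) (z : upper_half_plane R) :
    set (riemann_sphere R) :=
  [set Some (val (g z)) | g in hecke_group w].

Definition limit_set (R : realType) (w : R) : set (riemann_sphere R) :=
  \bigcup_z limit_point (hecke_orbit w z).

Local Open Scope ereal_scope.

(* Adding 0 makes the diameter of the empty set equal to 0. *)
Definition diameter (R : realType) (T : metricType R) (A : set T) : \bar R :=
  ereal_sup (0 |` [set (mdist p.1 p.2)%:E | p in A `*` A]).

(* The convention diam(A)^0 = 1 holds for nonempty A only. *)
Definition diameter_pow (R : realType) (T : metricType R) (s : R) (A : set T) :
    \bar R :=
  if `[< A = set0 >] then 0 else diameter A `^ s.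

Definition hausdorff_premeasure (R : realType) (T : metricType R) (s eps : R)
    (A : set T) : \bar R :=
  ereal_inf [set \sum_(0 <= i <oo) diameter_pow s (U i) | U in
    [set U : nat -> set T |
      A `<=` \bigcup_i U i /\ forall i, diameter (U i) <= eps%:E]].

Definition hausdorff_measure (R : realType) (T : metricType R) (s : R)
    (A : set T) : \bar R :=
  ereal_sup [set hausdorff_premeasure s eps A | eps in [set eps | (0 < eps)%R]].

Definition hausdorff_dim (R : realType) (T : metricType R) (A : set T) :
    \bar R :=
  ereal_inf [set s%:E | s in [set s | (0 <= s)%R /\ hausdorff_measure s A = 0]].

Definition hecke_delta (R : realType) (w : R) : \bar R :=
  hausdorff_dim (limit_set w).

(* Main.v *)
Require Import Defs.
From mathcomp Require Import all_boot all_order all_algebra.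
From mathcomp Require Import all_classical all_reals all_analysis.
From mathcomp Require Import complex ring lra zify.

Set Implicit Arguments.
Unset Strict Implicit.
Unset Printing Implicit Defensive.

Import Order.TTheory GRing.Theory Num.Theory.
Import numFieldNormedType.Exports.
Import ComplexField.Normc.

Local Open Scope classical_set_scope.
Local Open Scope ring_scope.

(** The group is generated by S and by translations by multiples of 3, so the
    orbit of infinity consists, apart from infinity itself, of the finite
    continued fractions

      3 k_0 - 1 / (3 k_1 - 1 / (3 k_2 - ...)),  k_i nonzero for i > 0,

    called [cusps] below, and the limit set is their closure together with
    infinity ([limit_set_sub], [closure_cusps_limit_set]). One inclusion uses
    that the group elements are integer matrices: a sequence of distinct orbit
    points g z that stays bounded has unbounded denominators c z + d, hence is
    asymptotic to the cusps g(infinity) = a / c. The part [core] of the limit set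
    in [-2/5, 2/5] is mapped into itself by the maps x |-> -1 / (3 j + x), j a
    nonzero integer, and every nonzero point of [core] is such an image; the
    rest of the limit set is contained in the image of [core] under the inversion
    S, an isometry of the chordal metric. So the dimension is that of [core].

    The derivative of x |-> -1 / (3 j + x) is (3 j + x)^-2. The growth of the sum of
    the s-th powers of the lengths of the pieces of [core] given by words of
    length m is therefore governed by the operator ([transfer], p = 2 s)

      L f (x) = sum over j of |3 j + x|^-p f (-1 / (3 j + x)).

    - If L f <= rho f for a positive f and rho < 1, these sums are at most a
      constant times rho^m, and the s-dimensional measure is zero
      ([hausdorff_measure_limit_set_eq0]).
    - If L f >= rho f with rho > 1, already for the operator with finitely many
      digits, then for some m the words of length m form a finite system with
      separated images and with derivatives at least r_w such that the sum of the
      r_w^s is at least 1. Splitting a finite cover of [core] into covers of the images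
      and pulling these back shows by induction on the number of sets that the
      cost of a cover is bounded below ([finite_cover_cost]), so the
      s-dimensional measure is not zero
      ([hausdorff_measure_limit_set_neq0]).

    The true dimension is close to 0.75194. The test functions 1 + c x^2 are
    sufficiently close to the positive eigenfunction of L to prove the first
    inequality at s = 0.7532 with rho = 0.9995 ([transfer_contracts]) and the
    second at s = 0.75075 with rho = 1.001 ([transfer_expands]). Expanding to
    second order in x reduces both to estimates of the sums of n^-p and n^-(p+2),
    obtained from a few initial terms and from the midpoint and trapezoid rules
    for the tails. *)

(** * Symmetric sums of negative powers *)

Section SymmetricPowers.
Variable R : realType.
Implicit Types p q u b : R.

Definition powsum q u : R := (1 - u) `^ (- q) + (1 + u) `^ (- q).
Definition powdiff q u : R := (1 - u) `^ (- q) - (1 + u) `^ (- q).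

Lemma is_derive_pow1B q u : u < 1 ->
  is_derive u 1 (fun v : R => (1 - v) `^ (- q)) (q * (1 - u) `^ (- (q + 1))).
Proof.
move=> u1.
have h : is_derive (1 - u) 1 (fun v : R => v `^ (- q)) (- q * (1 - u) `^ (- q - 1)).
  by apply: is_derive1_powR; rewrite subr_gt0.
have h2 : is_derive u 1 (fun v : R => 1 - v) (0 - 1) by apply: is_deriveB.
have := @is_derive1_comp R (fun v : R => v `^ (- q)) (fun v : R => 1 - v) u _ _ h h2.
by rewrite -opprD; congr (is_derive _ _ _ _); ring.
Qed.

Lemma is_derive_pow1D q u : - 1 < u ->
  is_derive u 1 (fun v : R => (1 + v) `^ (- q)) (- q * (1 + u) `^ (- (q + 1))).
Proof.
move=> u1.
have h : is_derive (1 + u) 1 (fun v : R => v `^ (- q)) (- q * (1 + u) `^ (- q - 1)).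
  by apply: is_derive1_powR; lra.
have h2 : is_derive u 1 (fun v : R => 1 + v) (0 + 1) by apply: is_deriveD.
have := @is_derive1_comp R (fun v : R => v `^ (- q)) (fun v : R => 1 + v) u _ _ h h2.
by rewrite -opprD; congr (is_derive _ _ _ _); ring.
Qed.

Lemma is_derive_powsum q u : - 1 < u < 1 ->
  is_derive u 1 (powsum q) (q * powdiff (q + 1) u).
Proof.
move=> /andP[u0 u1].
have := is_deriveD (is_derive_pow1B q u1) (is_derive_pow1D q u0).
by rewrite /powdiff mulrBr mulNr.
Qed.

Lemma is_derive_powdiff q u : - 1 < u < 1 ->
  is_derive u 1 (powdiff q) (q * powsum (q + 1) u).
Proof.
move=> /andP[u0 u1].
have := is_deriveB (is_derive_pow1B q u1) (is_derive_pow1D q u0).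
by rewrite /powsum mulrDr mulNr opprK.
Qed.

Lemma powsum0 q : powsum q 0 = 2.
Proof. by rewrite /powsum subr0 addr0 powR1. Qed.

Lemma powdiff0 q : powdiff q 0 = 0.
Proof. by rewrite /powdiff subr0 addr0 subrr. Qed.

(** Monotonicity on an interval [0, c] inside [0, 1), in the form in which it is
    used below: an inequality between derivatives integrates from 0. *)
Lemma le_from0 (f g df dg : R -> R) c :
  (forall u, 0 <= u <= c -> is_derive u 1 f (df u)) ->
  (forall u, 0 <= u <= c -> is_derive u 1 g (dg u)) ->
  (forall u, 0 <= u <= c -> df u <= dg u) ->
  f 0 = g 0 -> forall u, 0 <= u <= c -> f u <= g u.
Proof.
move=> hf hg hd e u /andP[u0 uc].
have hfg v : 0 <= v <= c -> is_derive v 1 (g \- f) (dg v - df v).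
  by move=> hv; apply: is_deriveB; [exact: hg|exact: hf].
have : (g \- f) 0 <= (g \- f) u.
  apply: (@ger0_derive1_ndecr R (g \- f) 0 c) => //.
  - move=> x; rewrite in_itv/= => /andP[x0 xc].
    by have /= [] := hfg x; rewrite ?(ltW x0) ?(ltW xc).
  - move=> x; rewrite in_itv/= => /andP[x0 xc].
    rewrite derive1E.
    have xx : 0 <= x <= c by rewrite (ltW x0) (ltW xc).
    have /= [_ ->] := hfg x xx.
    by rewrite subr_ge0 hd.
  - apply: continuous_in_subspaceT => x; rewrite inE/= in_itv/= => xx.
    by apply: differentiable_continuous; apply/derivable1_diffP; have [] := hfg x xx.
by rewrite /= e subrr subr_ge0.
Qed.

Let lt1_itv u : 0 <= u -> u < 1 -> - 1 < u < 1.
Proof. by move=> u0 u1; rewrite u1 andbT; lra. Qed.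

Lemma powR_antitone q (a b : R) : 0 <= q -> 0 < a -> a <= b ->
  b `^ (- q) <= a `^ (- q).
Proof.
move=> q0 a0 ab; rewrite !powRN lef_pV2 ?posrE ?powR_gt0//; last exact: lt_le_trans ab.
by apply: ge0_ler_powR; rewrite ?nnegrE ?(ltW a0)//; apply: le_trans ab; exact: ltW.
Qed.

Lemma powdiff_ge0 q u : 0 <= q -> 0 <= u < 1 -> 0 <= powdiff q u.
Proof.
by move=> q0 /andP[u0 u1]; rewrite subr_ge0 powR_antitone//; lra.
Qed.

Lemma powsum_ge0 q u : 0 <= powsum q u.
Proof. by rewrite addr_ge0// powR_ge0. Qed.

Lemma powsum_nondecreasing q u b : 0 <= q -> 0 <= u -> u <= b -> b < 1 ->
  powsum q u <= powsum q b.
Proof.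
move=> q0 u0 ub b1.
have hd x : u < x < b -> is_derive x 1 (powsum q) (q * powdiff (q + 1) x).
  by move=> /andP[ux xb]; apply: is_derive_powsum; apply: lt1_itv; lra.
apply: (@ger0_derive1_ndecr R (powsum q) u b) => //.
- by move=> x; rewrite in_itv/= => /hd[].
- move=> x; rewrite in_itv/= => xx; rewrite derive1E.
  have [_ ->] := hd _ xx; rewrite mulr_ge0// powdiff_ge0//; first by lra.
  by move/andP: xx => [ux xb]; apply/andP; split; lra.
- apply: continuous_in_subspaceT => x; rewrite inE/= in_itv/= => /andP[ux xb].
  apply: differentiable_continuous; apply/derivable1_diffP.
  have xx : - 1 < x < 1 by apply: lt1_itv; lra.
  by have [] := is_derive_powsum q xx.
Qed.

Lemma powsum_ge2 q u : 0 <= q -> 0 <= u < 1 -> 2 <= powsum q u.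
Proof.
by move=> q0 /andP[u0 u1]; rewrite -(powsum0 q) powsum_nondecreasing.
Qed.

Lemma is_derive_mulc (c u : R) : is_derive u 1 (fun v : R => c * v) c.
Proof.
have := @is_deriveZ R R R id c u 1 1 (is_derive_id _ _).
by rewrite /GRing.scale/= mulr1.
Qed.

Lemma is_derive_sqr (c u : R) :
  is_derive u 1 (fun v : R => 2 + c * v ^+ 2) (2 * c * u).
Proof.
have h : is_derive u 1 (fun v : R => v * v) (u *: 1 + u *: 1).
  by apply: is_deriveM; exact: is_derive_id.
have h2 := @is_deriveZ R R R (fun v => v * v) c u 1 _ h.
have := @is_deriveD R R R (cst 2) _ u 1 0 _ (is_derive_cst _ _ _) h2.
rewrite (_ : 0 + _ = 2 * c * u); last by rewrite /GRing.scale/=; ring.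
by rewrite (_ : cst 2 + _ = (fun v => 2 + c * v ^+ 2)).
Qed.

(** The convexity estimate behind the midpoint rule: the derivative of [powdiff]
    is smallest at 0. *)
Lemma powdiff_ge q u : 0 <= q -> 0 <= u < 1 -> 2 * q * u <= powdiff q u.
Proof.
move=> q0 /andP[u0 u1].
apply: (@le_from0 (fun v => 2 * q * v) (powdiff q) (fun=> 2 * q)
  (fun v => q * powsum (q + 1) v) u); rewrite ?u0 ?lexx// ?powdiff0 ?mulr0//.
- by move=> v _; exact: is_derive_mulc.
- by move=> v /andP[v0 vu]; apply: is_derive_powdiff; apply: lt1_itv; lra.
- move=> v /andP[v0 vu]; rewrite mulrC ler_wpM2l// powsum_ge2//; first lra.
  by apply/andP; split; lra.
Qed.

Lemma powsum_ge q u : 0 <= q -> 0 <= u < 1 ->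
  2 + q * (q + 1) * u ^+ 2 <= powsum q u.
Proof.
move=> q0 /andP[u0 u1].
apply: (@le_from0 (fun v => 2 + q * (q + 1) * v ^+ 2) (powsum q)
  (fun v => 2 * (q * (q + 1)) * v)
  (fun v => q * powdiff (q + 1) v) u); rewrite ?u0 ?lexx// ?powsum0 ?expr0n/= ?mulr0 ?addr0//.
- by move=> v _; exact: is_derive_sqr.
- by move=> v /andP[v0 vu]; apply: is_derive_powsum; apply: lt1_itv; lra.
- move=> v /andP[v0 vu].
  rewrite (_ : 2 * _ * v = q * (2 * (q + 1) * v)); last by ring.
  rewrite ler_wpM2l// powdiff_ge//; first lra.
  by apply/andP; split; lra.
Qed.

(** Since [powsum] is nondecreasing, its mean over [0, u] is at most its value
    at [u]; this is the convexity estimate behind the trapezoid rule. *)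
Lemma powdiff_le q u : 0 <= q -> 0 <= u < 1 ->
  powdiff q u <= q * u * powsum (q + 1) u.
Proof.
move=> q0 /andP[u0 u1].
rewrite (_ : q * u * _ = q * powsum (q + 1) u * u); last by ring.
apply: (@le_from0 (powdiff q) (fun v => q * powsum (q + 1) u * v)
  (fun v => q * powsum (q + 1) v) (fun=> q * powsum (q + 1) u) u);
  rewrite ?u0 ?lexx// ?powdiff0 ?mulr0//.
- by move=> v /andP[v0 vu]; apply: is_derive_powdiff; apply: lt1_itv; lra.
- by move=> v _; exact: is_derive_mulc.
- by move=> v /andP[v0 vu]; rewrite ler_wpM2l// powsum_nondecreasing//; lra.
Qed.

(** The second derivative of [powsum q] is [q * (q + 1) * powsum (q + 2)], which is
    nondecreasing, so on [0, b] it is at most its value at [b]. *)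
Lemma powsum_le q b u : 0 <= q -> 0 <= u -> u <= b -> b < 1 ->
  powsum q u <= 2 + q * (q + 1) * (powsum (q + 2) b / 2) * u ^+ 2.
Proof.
move=> q0 u0 ub b1; set M := powsum _ b.
apply: (@le_from0 (powsum q) (fun v => 2 + q * (q + 1) * (M / 2) * v ^+ 2)
  (fun v => q * powdiff (q + 1) v) (fun v => 2 * (q * (q + 1) * (M / 2)) * v) b);
  rewrite ?u0 ?ub// ?powsum0 ?expr0n/= ?mulr0 ?addr0//.
- by move=> v /andP[v0 vu]; apply: is_derive_powsum; apply: lt1_itv; lra.
- by move=> v _; exact: is_derive_sqr.
- move=> v /andP[v0 vu].
  rewrite (_ : 2 * _ * v = q * ((q + 1) * v * M)); last by field.
  rewrite ler_wpM2l// (le_trans (@powdiff_le _ _ _ _))//.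
  + by lra.
  + by apply/andP; split; lra.
  + rewrite -addrA ler_wpM2l//; first by rewrite mulr_ge0//; lra.
    by rewrite (_ : 1 + 1 = 2)// powsum_nondecreasing//; lra.
Qed.

End SymmetricPowers.

(** * Quadrature of negative powers *)

Section PowerTails.
Variable R : realType.
Implicit Types p q a b : R.

(** Rescales an interval [a, b] to [1 - t, 1 + t], so that the quadrature errors on
    [a, b] become statements on [powsum] and [powdiff]. *)
Lemma pow_scale q a b (m := (a + b) / 2) (t := (b - a) / (a + b)) :
  0 < a -> a <= b ->
  [/\ 0 < m, 0 <= t < 1, a `^ (- q) = m `^ (- q) * (1 - t) `^ (- q)
    & b `^ (- q) = m `^ (- q) * (1 + t) `^ (- q)].
Proof.
move=> a0 ab.
have s0 : 0 < a + b by lra.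
have m0 : 0 < m by rewrite divr_gt0.
have t01 : 0 <= t < 1.
  by rewrite /t divr_ge0 ?subr_ge0 ?(ltW s0)//= ltr_pdivrMr// mul1r; lra.
have ea : a = m * (1 - t) by rewrite /m /t; field; rewrite gt_eqF.
have eb : b = m * (1 + t) by rewrite /m /t; field; rewrite gt_eqF.
split => //.
- by rewrite {1}ea powRM ?(ltW m0)//; lra.
- by rewrite {1}eb powRM ?(ltW m0)//; lra.
Qed.

Lemma powRB1 q a : 0 < a -> a `^ (- (q + 1)) = a `^ (- q) / a.
Proof.
move=> a0; rewrite opprD powRD; last by rewrite (gt_eqF a0) implybT.
by rewrite powR_inv1 ?ltW.
Qed.

Lemma pow_midpoint q a b : 0 <= q -> 0 < a -> a <= b ->
  q * (b - a) * ((a + b) / 2) `^ (- (q + 1)) <= a `^ (- q) - b `^ (- q).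
Proof.
move=> q0 a0 ab; have [] := @pow_scale q a b a0 ab.
set m := (a + b) / 2; set t := (b - a) / (a + b) => m0 t01 -> ->.
rewrite powRB1// -mulrBr.
rewrite (_ : q * (b - a) * _ = m `^ (- q) * (2 * q * t)); last first.
  by rewrite /m /t; field; rewrite gt_eqF//; lra.
by rewrite ler_wpM2l ?powR_ge0// powdiff_ge.
Qed.

Lemma pow_trapezoid q a b : 0 <= q -> 0 < a -> a <= b ->
  a `^ (- q) - b `^ (- q) <=
  q * (b - a) / 2 * (a `^ (- (q + 1)) + b `^ (- (q + 1))).
Proof.
move=> q0 a0 ab; have [_ _ -> ->] := @pow_scale (q + 1) a b a0 ab.
have [] := @pow_scale q a b a0 ab.
set m := (a + b) / 2; set t := (b - a) / (a + b) => m0 t01 -> ->.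
rewrite powRB1// -mulrBr -mulrDr.
rewrite (_ : q * (b - a) / 2 * _ = m `^ (- q) * (q * t * powsum (q + 1) t)); last first.
  by rewrite /powsum /m /t; field; rewrite gt_eqF//; lra.
by rewrite ler_wpM2l ?powR_ge0// powdiff_le.
Qed.

(** The midpoint rule, applied on the intervals of length 1 centred at the points
    of summation, overestimates the sum by a telescoping one. *)
Lemma sum_pow_le q a N : 0 < q -> 2^-1 < a ->
  \sum_(0 <= k < N) (a + k%:R) `^ (- (q + 1)) <= (a - 2^-1) `^ (- q) / q.
Proof.
move=> q0 a0; rewrite ler_pdivlMr//.
suff h : (\sum_(0 <= k < N) (a + k%:R) `^ (- (q + 1))) * q <=
    (a - 2^-1) `^ (- q) - (a + N%:R - 2^-1) `^ (- q).
  by apply: le_trans h _; rewrite gerBl powR_ge0.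
elim: N => [|N IH]; first by rewrite big_nil mul0r addr0 subrr.
rewrite big_nat_recr//= mulrDl.
have N0 : 0 <= N%:R :> R by [].
have h := @pow_midpoint q (a + N%:R - 2^-1) (a + N.+1%:R - 2^-1) (ltW q0).
move: h; rewrite -(natr1 N) (_ : (_ + _) / 2 = a + N%:R); last by field.
rewrite (_ : a + (N%:R + 1) - 2^-1 - _ = 1) ?mulr1; last by ring.
by move=> h; have {}h := h ltac:(lra) ltac:(lra); lra.
Qed.

(** The trapezoid rule on the intervals between the points of summation; the half
    term at the last point is dropped. *)
Lemma sum_pow_ge q a N : 0 < q -> 0 < a ->
  (a `^ (- q) - (a + N%:R) `^ (- q)) / q + a `^ (- (q + 1)) / 2 <=
  \sum_(0 <= k < N.+1) (a + k%:R) `^ (- (q + 1)).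
Proof.
move=> q0 a0.
suff h : (a `^ (- q) - (a + N%:R) `^ (- q)) / q + a `^ (- (q + 1)) / 2
      + (a + N%:R) `^ (- (q + 1)) / 2 <=
    \sum_(0 <= k < N.+1) (a + k%:R) `^ (- (q + 1)).
  by apply: le_trans h; rewrite lerDl divr_ge0 ?powR_ge0.
elim: N => [|N IH]; first by rewrite big_nat1 addr0 subrr mul0r; lra.
rewrite big_nat_recr//=.
have N0 : 0 <= N%:R :> R by [].
have h := @pow_trapezoid q (a + N%:R) (a + N.+1%:R) (ltW q0).
move: h IH; rewrite -(natr1 N) (_ : a + (N%:R + 1) - _ = 1) ?mulr1; last by ring.
set u := (a + N%:R) `^ (- q); set v := (a + (_ + _)) `^ (- q).
set u' := (a + N%:R) `^ (- (q + 1)); set v' := (a + _) `^ (- (q + 1)).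
move=> h IH; have {}h := h ltac:(lra) ltac:(lra).
have {}h : (u - v) / q <= (u' + v') / 2.
  by rewrite ler_pdivrMr//; lra.
rewrite (_ : (_ - v) / q = (a `^ (- q) - u) / q + (u - v) / q); last by rewrite -mulrDl; congr (_ / _); ring.
by lra.
Qed.

(** [t <= ln a] follows from [expR (- t) >= (1 - t / 8) ^+ 8], which is accurate
    enough for the values of [t] up to 1 needed here. *)
Lemma ln_ge t a : 0 < a -> t < 8 -> a^-1 <= (1 - t / 8) ^+ 8 -> t <= ln a.
Proof.
move=> a0 t8 h; rewrite -[t]expRK ler_ln ?posrE ?expR_gt0//.
rewrite -[t]opprK expRN -[a]invrK lef_pV2 ?posrE ?invr_gt0 ?expR_gt0//.
apply: le_trans h _.
rewrite (_ : - t = 8%:R * (- (t / 8))); last by field.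
rewrite expRM_natl lerXn2r ?nnegrE ?expR_ge0 ?expR_ge1Dx//; lra.
Qed.

Lemma powRN_le t e a : 0 <= e -> 1 <= a -> 0 <= t -> t < 8 ->
  a^-1 <= (1 - t / 8) ^+ 8 -> a `^ (- e) <= (1 + e * t)^-1.
Proof.
move=> e0 a1 t0 t8 h; have a0 : 0 < a by exact: lt_le_trans a1.
have h1 := ln_ge a0 t8 h.
rewrite powRN lef_pV2 ?posrE ?powR_gt0//; last by rewrite ltr_pwDl// mulr_ge0.
rewrite /powR gt_eqF//; apply: le_trans (expR_ge1Dx _).
by rewrite lerD2l ler_wpM2l.
Qed.

(** From [ln a = 2 * ln (sqrt a)] and [ln (1 + x) <= x]. *)
Lemma powRN_ge e a : 0 <= e -> 0 < a ->
  1 - 2 * e * (Num.sqrt a - 1) <= a `^ (- e).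
Proof.
move=> e0 a0; rewrite /powR gt_eqF//; apply: le_trans (expR_ge1Dx _).
rewrite mulNr lerD2l lerN2.
have s0 : 0 < Num.sqrt a by rewrite sqrtr_gt0.
rewrite -[in leLHS](sqr_sqrtr (ltW a0)) lnXn//.
rewrite (_ : e * _ = 2 * e * ln (Num.sqrt a)); last by ring.
rewrite ler_wpM2l//; first by rewrite mulr_ge0.
by have := le_ln1Dx (x := Num.sqrt a - 1); rewrite (addrC 1) subrK; apply; lra.
Qed.

End PowerTails.

(** * Digits and the transfer operator *)

(** The digits of the continued fractions attached to the group are the nonzero
    multiples of 3; a letter records the sign of a digit and its rank. *)
Definition letter : Type := (bool * nat)%type.

Definition digit (R : realType) (l : letter) : R :=
  if l.1 then - (3 * l.2.+1%:R) else 3 * l.2.+1%:R.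

Definition letters (N : nat) : seq letter :=
  [seq (b, n) | b <- [:: false; true], n <- iota 0 N].

Section Transfer.
Variable R : realType.
Implicit Types (p q c x : R) (f : R -> R).

Definition transfer p f N x : R :=
  \sum_(l <- letters N) `|digit R l + x| `^ (- p) * f (- (digit R l + x)^-1).

(** The test functions: the leading eigenfunction of the operator is even and
    close to a parabola on [-2/5, 2/5]. *)
Definition parabola c x : R := 1 + c * x ^+ 2.

Definition digit_sum q N : R := \sum_(0 <= n < N) (3 * n.+1%:R) `^ (- q).

(** The digits d and -d together contribute a symmetric sum, whose expansion in x
    has no odd terms. *)
Lemma pow_pair q (d x : R) : `|x| < d ->
  (d + x) `^ (- q) + (d - x) `^ (- q) = d `^ (- q) * powsum q (`|x| / d).
Proof.
move=> xd; have d0 : 0 < d by exact: le_lt_trans xd.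
have sc y : `|y| < d -> (d + y) `^ (- q) = d `^ (- q) * (1 + y / d) `^ (- q).
  rewrite ltr_norml => /andP[y0 y1].
  rewrite -powRM ?(ltW d0)//; first by congr (_ `^ _); field; rewrite gt_eqF.
  by rewrite -(ler_pM2r d0) mul0r mulrDl mul1r divfK ?gt_eqF//; lra.
rewrite !sc ?normrN// /powsum -mulrDr; congr (_ * _).
by case: (ger0P x) => _; rewrite ?mulNr ?opprK// addrC.
Qed.

Lemma transferE p c N x : `|x| <= 2 / 5 ->
  transfer p (parabola c) N x =
  \sum_(0 <= n < N) ((3 * n.+1%:R) `^ (- p) * powsum p (`|x| / (3 * n.+1%:R))
    + c * ((3 * n.+1%:R) `^ (- (p + 2)) * powsum (p + 2) (`|x| / (3 * n.+1%:R)))).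
Proof.
move=> x25; rewrite /transfer /letters big_allpairs. rewrite !big_cons big_nil /= addr0.
rewrite -big_split /index_iota subn0; apply: eq_bigr => n _.
rewrite /digit/=.
set d : R := 3 * n.+1%:R.
have d3 : 3 <= d by rewrite /d ler_peMr// ler1n.
have xd : `|x| < d by apply: le_lt_trans x25 _; apply: lt_le_trans d3; lra.
rewrite -!pow_pair//.
have [x0 x1] : - d < x /\ x < d by move: xd; rewrite ltr_norml => /andP[].
have e1 : `|d + x| = d + x by rewrite ger0_norm; lra.
have e2 : `|- d + x| = d - x by rewrite ler0_norm; lra.
rewrite e1 e2 /parabola.
have sq y : 0 < y -> y `^ (- (p + 2)) = y `^ (- p) * (y^-1) ^+ 2.
  move=> y0; rewrite opprD powRD; last by rewrite (gt_eqF y0) implybT.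
  by rewrite powR_invn ?ltW// exprVn.
rewrite !sq; [|lra|lra].
have -> : - d + x = - (d - x) by ring.
by rewrite invrN opprK sqrrN; ring.
Qed.

Lemma digit_sum_step (n : nat) q : (3 * n.+1%:R : R) `^ (- q) =
  3 `^ (- q) * (1 + n%:R) `^ (- q).
Proof. by rewrite powRM// nat1r. Qed.

Lemma pow_shift q (d : R) (k : nat) : 0 < d ->
  d `^ (- (q + k%:R)) = d `^ (- q) / d ^+ k.
Proof.
move=> d0; rewrite opprD powRD; last by rewrite (gt_eqF d0) implybT.
by rewrite powR_invn ?ltW.
Qed.

(** The terms for the digits 3 and 6 are kept, the others are bounded by an
    integral from 5/2. *)
Lemma digit_sum_le q N : 0 < q -> digit_sum (q + 1) N <=
  3 `^ (- (q + 1)) * (1 + 2 `^ (- (q + 1)) + (5 / 2) `^ (- q) / q).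
Proof.
move=> q0; rewrite /digit_sum.
under eq_bigr do rewrite digit_sum_step.
rewrite -mulr_sumr ler_wpM2l ?powR_ge0//.
apply: (@le_trans _ _ (\sum_(0 <= n < N.+2) (1 + n%:R : R) `^ (- (q + 1)))).
  rewrite (@big_cat_nat _ _ _ N 0 N.+2)//=; last by lia.
  by rewrite lerDl sumr_ge0// => i _; rewrite powR_ge0.
rewrite big_nat_recl// big_nat_recl// addr0 powR1 -[1 + 1%:R]/(2%:R) -!addrA !lerD2l.
have h := @sum_pow_le R q 3 N q0.
rewrite (_ : 5 / 2 = 3 - 2^-1); last by field.
apply: le_trans (h _); last by lra.
apply: ler_sum => n _; rewrite le_eqVlt; apply/orP; left; apply/eqP; congr (_ `^ _).
by rewrite -!natr1; ring.
Qed.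

(** The terms for the digits 3, 6 and 9 are kept, the others are bounded by an
    integral from 4. *)
Lemma digit_sum_ge q N : 0 < q ->
  3 `^ (- (q + 1)) * (1 + 2 `^ (- (q + 1)) + 3 `^ (- (q + 1))
     + (4 `^ (- q) - (4 + N%:R) `^ (- q)) / q + 4 `^ (- (q + 1)) / 2) <=
  digit_sum (q + 1) N.+4.
Proof.
move=> q0; rewrite /digit_sum.
under [leRHS]eq_bigr do rewrite digit_sum_step.
rewrite -mulr_sumr ler_wpM2l ?powR_ge0//.
rewrite big_nat_recl// big_nat_recl// big_nat_recl// addr0 powR1.
rewrite -[1 + 1%:R]/(2%:R) (nat1r 2) -!addrA !lerD2l.
have h := @sum_pow_ge R q 4 N q0.
rewrite (_ : 1 + (1 + _) = 4 + N%:R); last by ring.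
apply: le_trans (h _) _; first by lra.
apply: ler_sum => n _; rewrite le_eqVlt; apply/orP; left; apply/eqP; congr (_ `^ _).
by rewrite -!natr1; ring.
Qed.

End Transfer.

(** * Estimates of the transfer operator by digit sums *)

Section Numerics.
Variable R : realType.
Implicit Types (a c p x : R) (N : nat).

(** The exponents in use are close to 3/2 and 1/2, so the powers are a square root
    times a correction close to 1. *)
Lemma powR_three_halves a e : 0 < a ->
  a `^ (- (3 / 2 + e)) = (a * Num.sqrt a)^-1 * a `^ (- e).
Proof.
move=> a0; rewrite opprD powRD; last by rewrite (gt_eqF a0) implybT.
congr (_ * _); rewrite (_ : 3 / 2 = 1 + 2^-1); last by field.
by rewrite powRN powRD ?powRr1 ?powR12_sqrt ?ltW//; rewrite (gt_eqF a0) implybT.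
Qed.

Lemma powR_half a e : 0 < a ->
  a `^ (- (2^-1 + e)) = (Num.sqrt a)^-1 * a `^ (- e).
Proof.
move=> a0; rewrite opprD powRD; last by rewrite (gt_eqF a0) implybT.
by rewrite powRN powR12_sqrt ?ltW.
Qed.

(** A certificate for an upper bound [B]: [l] is a lower bound of the square root of
    [a], and [t] one of its logarithm. *)
Lemma powR_upper a e t l B : 0 <= e -> 1 <= a -> 0 <= t -> t < 8 ->
  a^-1 <= (1 - t / 8) ^+ 8 -> 0 < l -> l ^+ 2 <= a ->
  1 <= B * (l * (1 + e * t)) -> (Num.sqrt a)^-1 * a `^ (- e) <= B.
Proof.
move=> e0 a1 t0 t8 h l0 la hB.
have a0 : 0 < a by exact: lt_le_trans a1.
have s1 : l <= Num.sqrt a.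
  by rewrite -(ger0_norm (ltW l0)) -sqrtr_sqr ler_sqrt// ltW.
have et : 0 < 1 + e * t by rewrite ltr_pwDl// mulr_ge0.
apply: (@le_trans _ _ (l^-1 * (1 + e * t)^-1)).
  rewrite ler_pM ?invr_ge0 ?sqrtr_ge0 ?powR_ge0//.
    by rewrite lef_pV2 ?posrE// (lt_le_trans l0).
  exact: powRN_le.
by rewrite -invfM -[leLHS]mul1r ler_pdivrMr ?mulr_gt0.
Qed.

(** A certificate for a lower bound [B]: [u] is an upper bound of the square root
    of [a]. *)
Lemma powR_lower a e u B : 0 <= e -> 0 < a -> 0 < u -> a <= u ^+ 2 ->
  0 <= 1 - 2 * e * (u - 1) ->
  B * u <= 1 - 2 * e * (u - 1) -> B <= (Num.sqrt a)^-1 * a `^ (- e).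
Proof.
move=> e0 a0 u0 au h0 hB.
have s0 : 0 < Num.sqrt a by rewrite sqrtr_gt0.
have s1 : Num.sqrt a <= u.
  by rewrite -(ger0_norm (ltW u0)) -sqrtr_sqr ler_sqrt// sqr_ge0.
apply: (@le_trans _ _ (u^-1 * (1 - 2 * e * (u - 1)))).
  by rewrite mulrC ler_pdivlMr.
rewrite ler_pM ?invr_ge0 ?(ltW u0)//; first by rewrite lef_pV2 ?posrE.
apply: le_trans (powRN_ge e0 a0).
by rewrite lerB// ler_wpM2l ?lerD2r// mulr_ge0.
Qed.

(** The largest value of [|x| / d] is [(2 / 5) / 3 = 2 / 15]; there the real
    exponent is rounded to integers in the unfavourable direction. *)
Lemma powsum_edge_le p (m n : nat) : n%:R <= p <= m%:R ->
  powsum p (2 / 15 : R) <= (15 / 13) ^+ m + (15 / 17) ^+ n.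
Proof.
move=> /andP[np pm]; rewrite /powsum.
rewrite (_ : 1 - 2 / 15 = 13 / 15); last by field.
rewrite (_ : 1 + 2 / 15 = 17 / 15); last by field.
have a0 : 0 < 13 / 15 :> R by lra.
have b0 : 0 < 17 / 15 :> R by lra.
rewrite lerD//.
  rewrite powRN -[15 / 13]invf_div exprVn lef_pV2 ?posrE ?powR_gt0 ?exprn_gt0//.
  by rewrite -powR_mulrn ?(ltW a0)//; apply: ger_powR => //; apply/andP; split; lra.
rewrite -[15 / 17]invf_div exprVn powRN lef_pV2 ?posrE ?powR_gt0 ?exprn_gt0//.
by rewrite -powR_mulrn ?(ltW b0)//; apply: ler_powR => //; lra.
Qed.

(** The correction of relative size [(|x| / d) ^+ 2 <= x ^+ 2 / 9] in the term with
    factor [c] is bounded crudely, the main one exactly to second order. *)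
Lemma transfer_term_le p c (K K' d x : R) : 0 <= p -> 0 <= c -> 0 <= K' ->
  p * (p + 1) * (powsum (p + 2) (2 / 15) / 2) <= K ->
  (p + 2) * (p + 2 + 1) * (powsum (p + 2 + 2) (2 / 15) / 2) <= K' ->
  3 <= d -> `|x| <= 2 / 5 ->
  d `^ (- p) * powsum p (`|x| / d)
    + c * (d `^ (- (p + 2)) * powsum (p + 2) (`|x| / d)) <=
  2 * d `^ (- p) + (2 * c + (K + K' * c / 9) * x ^+ 2) * d `^ (- (p + 2)).
Proof.
move=> p0 c0 K'0 hK hK' d3 x25.
have d0 : 0 < d by apply: lt_le_trans d3.
have u0 : 0 <= `|x| / d by rewrite divr_ge0// ltW.
have ub : `|x| / d <= 2 / 15 by rewrite ler_pdivrMr//; lra.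
have l1 : 2 / 15 < 1 :> R by lra.
have b1 : powsum p (`|x| / d) <= 2 + K * (`|x| / d) ^+ 2.
  by apply: le_trans (powsum_le p0 u0 ub l1) _; rewrite lerD2l ler_wpM2r ?sqr_ge0.
have b2 : powsum (p + 2) (`|x| / d) <= 2 + K' * (`|x| / d) ^+ 2.
  apply: le_trans (powsum_le _ u0 ub l1) _; first by rewrite addr_ge0.
  by rewrite lerD2l ler_wpM2r ?sqr_ge0.
have sq : d `^ (- (p + 2)) = d `^ (- p) / d ^+ 2 by rewrite (@pow_shift R p d 2).
have e1 : d `^ (- p) * (`|x| / d) ^+ 2 = x ^+ 2 * d `^ (- (p + 2)).
  by rewrite sq expr_div_n real_normK ?num_real//; ring.
have e2 : (`|x| / d) ^+ 2 <= x ^+ 2 / 9.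
  rewrite expr_div_n real_normK ?num_real// ler_wpM2l ?sqr_ge0//.
  rewrite lef_pV2 ?posrE ?exprn_gt0// (_ : 9 = 3 ^+ 2); last by rewrite -natrX.
  by rewrite lerXn2r ?nnegrE// ltW.
have A0 := powR_ge0 d (- p); have B0 := powR_ge0 d (- (p + 2)).
have f1 := ler_wpM2l A0 b1.
have f2 := ler_wpM2l c0 (ler_wpM2l B0 b2).
have f3 := ler_wpM2l c0 (ler_wpM2l B0 (ler_wpM2l K'0 e2)).
apply: le_trans (lerD f1 f2) _.
set A := d `^ (- p) in e1 *; set B := d `^ _ in e1 f3 *; set u := `|x| / d in e1 f3 *.
rewrite (_ : A * _ + _ = A * 2 + K * (A * u ^+ 2) + c * (B * 2) + c * (B * (K' * u ^+ 2)));
  last by ring.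
rewrite e1 (_ : 2 * A + _ = A * 2 + K * (x ^+ 2 * B) + c * (B * 2)
  + c * (B * (K' * (x ^+ 2 / 9)))); last by ring.
by rewrite lerD2l.
Qed.

Lemma transfer_term_ge p c (d x : R) : 0 <= p -> 0 <= c -> 3 <= d -> `|x| <= 2 / 5 ->
  2 * d `^ (- p) + (2 * c + p * (p + 1) * x ^+ 2) * d `^ (- (p + 2)) <=
  d `^ (- p) * powsum p (`|x| / d)
    + c * (d `^ (- (p + 2)) * powsum (p + 2) (`|x| / d)).
Proof.
move=> p0 c0 d3 x25.
have d0 : 0 < d by apply: lt_le_trans d3.
have u01 : 0 <= `|x| / d < 1.
  by rewrite divr_ge0 ?(ltW d0)//= ltr_pdivrMr// mul1r; lra.
have sq : d `^ (- (p + 2)) = d `^ (- p) / d ^+ 2 by rewrite (@pow_shift R p d 2).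
have e1 : d `^ (- p) * (`|x| / d) ^+ 2 = x ^+ 2 * d `^ (- (p + 2)).
  by rewrite sq expr_div_n real_normK ?num_real//; ring.
have A0 := powR_ge0 d (- p); have B0 := powR_ge0 d (- (p + 2)).
have f1 := ler_wpM2l A0 (powsum_ge p0 u01).
have f2 := ler_wpM2l c0 (ler_wpM2l B0 (powsum_ge2 (addr_ge0 p0 (ler0n R 2)) u01)).
apply: le_trans (lerD f1 f2).
set A := d `^ (- p) in e1 *; set B := d `^ _ in e1 *; set u := `|x| / d in e1 *.
rewrite (_ : A * (2 + _) = 2 * A + p * (p + 1) * (A * u ^+ 2)); last by ring.
by rewrite e1 le_eqVlt; apply/orP; left; apply/eqP; ring.
Qed.

Lemma transfer_le_digit_sum p c (K K' : R) N x : 0 <= p -> 0 <= c -> 0 <= K' ->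
  p * (p + 1) * (powsum (p + 2) (2 / 15) / 2) <= K ->
  (p + 2) * (p + 2 + 1) * (powsum (p + 2 + 2) (2 / 15) / 2) <= K' ->
  `|x| <= 2 / 5 ->
  transfer p (parabola c) N x <=
  2 * digit_sum p N + (2 * c + (K + K' * c / 9) * x ^+ 2) * digit_sum (p + 2) N.
Proof.
move=> p0 c0 K'0 hK hK' x25; rewrite transferE// /digit_sum !mulr_sumr -big_split/=.
by apply: ler_sum => n _; apply: transfer_term_le => //; rewrite ler_peMr// ler1n.
Qed.

(** All digits contribute to the leading term; in the smaller terms, of order
    [d `^ (- (p + 2))], only the digits 3 and 6 are kept. *)
Lemma transfer_ge_digit_sum p c N x : 0 <= p -> 0 <= c -> `|x| <= 2 / 5 ->
  2 * digit_sum p N.+2 +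
    (2 * c + p * (p + 1) * x ^+ 2) * (3 `^ (- (p + 2)) * (1 + 2 `^ (- (p + 2)))) <=
  transfer p (parabola c) N.+2 x.
Proof.
move=> p0 c0 x25; rewrite transferE//.
apply: (@le_trans _ _ (2 * digit_sum p N.+2 +
  (2 * c + p * (p + 1) * x ^+ 2) * digit_sum (p + 2) N.+2)); last first.
  rewrite /digit_sum !mulr_sumr -big_split/=.
  by apply: ler_sum => n _; apply: transfer_term_ge => //; rewrite ler_peMr// ler1n.
have C0 : 0 <= 2 * c + p * (p + 1) * x ^+ 2.
  apply: addr_ge0; first exact: mulr_ge0.
  by apply: mulr_ge0 (sqr_ge0 _); apply: mulr_ge0 => //; exact: addr_ge0.
rewrite lerD2l; apply: (ler_wpM2l C0).
rewrite /digit_sum big_nat_recl// big_nat_recl// mulrDr mulr1 -powRM//.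
by rewrite mulr1 lerD2l lerDl sumr_ge0// => i _; exact: powR_ge0.
Qed.

End Numerics.

(** * Contraction at dimension 0.7532 *)

Lemma three_pow_upper (R : realType) : (3 : R) `^ (- (3 / 2 + 4 / 625)) <= 22 / 115.
Proof.
rewrite powR_three_halves// invfM -mulrA mulrC ler_pdivrMr//.
by apply: (@powR_upper _ _ _ 1 (168 / 97)); clear; lra.
Qed.

Lemma two_pow_upper (R : realType) : (2 : R) `^ (- (3 / 2 + 4 / 625)) <= 31 / 88.
Proof.
rewrite powR_three_halves// invfM -mulrA mulrC ler_pdivrMr//.
by apply: (@powR_upper _ _ _ (65 / 100) (41 / 29)); clear; lra.
Qed.

Lemma five_halves_pow_upper (R : realType) : (5 / 2 : R) `^ (- (2^-1 + 4 / 625)) <= 56 / 89.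
Proof.
rewrite powR_half; last by clear; lra.
by apply: (@powR_upper _ _ _ (85 / 100) (117 / 74)); clear; lra.
Qed.

Lemma powsum_curvature_le (R : realType) (p P M K : R) (m n : nat) : 0 <= p -> p <= P ->
  n%:R <= p + 2 <= m%:R -> (15 / 13) ^+ m + (15 / 17) ^+ n <= M ->
  P * (P + 1) * (M / 2) <= K ->
  p * (p + 1) * (powsum (p + 2) (2 / 15) / 2) <= K.
Proof.
move=> p0 pP mn hM hK; apply: le_trans hK.
have h := le_trans (powsum_edge_le mn) hM.
have h0 := @powsum_ge0 R (p + 2) (2 / 15).
have p1 : 0 <= p + 1 by rewrite addr_ge0.
rewrite ler_pM ?mulr_ge0 ?divr_ge0//; last by rewrite ler_pM2r ?invr_gt0.
by rewrite ler_pM// lerD2r.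
Qed.

Lemma digit_sum_upper (R : realType) N : digit_sum (3 / 2 + 4 / 625 : R) N <= 149 / 300.
Proof.
set p : R := 3 / 2 + 4 / 625; set q : R := 2^-1 + 4 / 625.
have pq : p = q + 1 by rewrite /p /q; field.
have qb : 506 / 1000 <= q by rewrite /q; clear; lra.
have d0 : 0 < 506 / 1000 :> R by clear; lra.
have q0 : 0 < q by apply: lt_le_trans qb.
rewrite pq; apply: le_trans (digit_sum_le _ q0) _; rewrite -pq.
have h3 := three_pow_upper R; have h2 := two_pow_upper R.
have h5 := five_halves_pow_upper R.
apply: (@le_trans _ _ (22 / 115 * (1 + 31 / 88 + 56 / 89 / (506 / 1000)))); last first.
  by clear; lra.
apply: ler_pM; rewrite ?powR_ge0//.
  by rewrite addr_ge0 ?divr_ge0 ?(ltW q0) ?addr_ge0 ?powR_ge0.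
rewrite lerD ?lerD2l// ler_pM ?invr_ge0 ?(ltW q0) ?powR_ge0//.
by rewrite lef_pV2 ?posrE.
Qed.

Lemma digit_sum_shift_upper (R : realType) N : digit_sum (3 / 2 + 4 / 625 + 2 : R) N <= 3 / 125.
Proof.
set p : R := 3 / 2 + 4 / 625; set q : R := 2^-1 + 4 / 625.
have pq : p + 2 = q + 2 + 1 by rewrite /p /q; field.
have qb : 25 / 10 <= q + 2 by rewrite /q; clear; lra.
have d0 : 0 < 25 / 10 :> R by clear; lra.
have q0 : 0 < q + 2 by apply: lt_le_trans qb.
rewrite pq; apply: le_trans (digit_sum_le _ q0) _; rewrite -pq.
have h3 := three_pow_upper R; have h2 := two_pow_upper R.
have h5 := five_halves_pow_upper R.
apply: (@le_trans _ _ (22 / 115 / 3 ^+ 2 * (1 + 31 / 88 / 2 ^+ 2 +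
  56 / 89 / (5 / 2) ^+ 2 / (25 / 10)))); last by clear; lra.
have f0 : 0 < 5 / 2 :> R by clear; lra.
rewrite !(pow_shift _ 2)//.
have i2 (a : R) : 0 <= a -> 0 <= (a ^+ 2)^-1 by move=> a0; rewrite invr_ge0 sqr_ge0.
apply: ler_pM; rewrite ?mulr_ge0 ?powR_ge0 ?i2//.
- by rewrite !addr_ge0 ?mulr_ge0 ?powR_ge0 ?i2 ?invr_ge0 ?(ltW q0) ?(ltW f0).
- by rewrite ler_wpM2r ?i2.
apply: lerD; first by rewrite lerD2l ler_wpM2r ?i2.
apply: ler_pM; rewrite ?mulr_ge0 ?powR_ge0 ?i2 ?invr_ge0 ?(ltW q0) ?(ltW f0)//.
- by rewrite ler_wpM2r ?i2 ?(ltW f0).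
- by rewrite lef_pV2 ?posrE.
Qed.

(** Comparing the coefficients of 1 and of [x ^+ 2] on both sides: the choice
    [c = 3 / 25] makes both inequalities hold. *)
Lemma transfer_contracts (R : realType) N (x : R) : `|x| <= 2 / 5 ->
  transfer (3 / 2 + 4 / 625) (parabola (3 / 25)) N x <=
  1999 / 2000 * parabola (3 / 25) x.
Proof.
move=> x25; set p : R := 3 / 2 + 4 / 625.
have [p1 p2] : 3 / 2 <= p /\ p <= 1507 / 1000 by rewrite /p; clear; split; lra.
have M1 : p * (p + 1) * (powsum (p + 2) (2 / 15) / 2) <= 93 / 20.
  by apply: (@powsum_curvature_le _ _ (1507 / 1000) (246 / 100) _ 4 3);
    [lra|lra|apply/andP; split; lra|clear; lra|clear; lra].
have M2 : (p + 2) * (p + 2 + 1) * (powsum (p + 2 + 2) (2 / 15) / 2) <= 23.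
  by apply: (@powsum_curvature_le _ _ (3507 / 1000) (2895 / 1000) _ 6 5);
    [lra|lra|apply/andP; split; lra|clear; lra|clear; lra].
have c0 : 0 <= 3 / 25 :> R by clear; lra.
apply: le_trans (transfer_le_digit_sum N _ c0 _ M1 M2 x25) _; [lra|by []|].
have S1 := digit_sum_upper R N; have S2 := digit_sum_shift_upper R N.
have x2 := sqr_ge0 x.
have h := ler_wpM2l x2 S2.
rewrite -/p in S1 S2 h; rewrite /parabola; clear -S1 S2 h x2.
by lra.
Qed.

(** * Expansion at dimension 0.75075 *)

Lemma three_pow_lower (R : realType) : 24 / 125 <= (3 : R) `^ (- (3 / 2 + 3 / 2000)).
Proof.
rewrite powR_three_halves// invfM -mulrA [leRHS]mulrC ler_pdivlMr//.
by apply: (@powR_lower _ _ _ (97 / 56)); clear; lra.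
Qed.

Lemma two_pow_lower (R : realType) : 6 / 17 <= (2 : R) `^ (- (3 / 2 + 3 / 2000)).
Proof.
rewrite powR_three_halves// invfM -mulrA [leRHS]mulrC ler_pdivlMr//.
by apply: (@powR_lower _ _ _ (99 / 70)); clear; lra.
Qed.

Lemma pow_vanishes (R : realType) (q a eta : R) : 0 < q -> 0 < eta -> 0 <= a ->
  exists N : nat, (a + N%:R) `^ (- q) <= eta.
Proof.
move=> q0 eta0 a0; set y := eta^-1 `^ q^-1.
have y0 : 0 <= y by exact: powR_ge0.
exists (Num.truncn y).+1; set m := _%:R.
have ym : y <= a + m.
  by apply: le_trans (ltW (truncnS_gt _)) _; rewrite lerDr.
have m0 : 0 < a + m by rewrite ltr_wpDl// ltr0n.
rewrite powRN -[eta]invrK lef_pV2 ?posrE ?powR_gt0 ?invr_gt0//.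
have -> : eta^-1 = y `^ q by rewrite /y -powRrM mulVf ?gt_eqF// powRr1// invr_ge0 ltW.
by apply: ge0_ler_powR; rewrite ?nnegrE ?(ltW q0)// ltW.
Qed.

Lemma digit_sum_lower (R : realType) : exists N,
  312 / 625 <= digit_sum (3 / 2 + 3 / 2000 : R) N.+2.
Proof.
set p : R := 3 / 2 + 3 / 2000; set q : R := 2^-1 + 3 / 2000.
have pq : p = q + 1 by rewrite /p /q; field.
have qE : q = 1003 / 2000 by rewrite /q; clear; lra.
have q0 : 0 < q by rewrite /q; clear; lra.
have [N hN] : exists N : nat, (4 + N%:R) `^ (- q) <= 1 / 5000.
  by apply: (pow_vanishes q0); clear; lra.
exists N.+2; rewrite pq; apply: le_trans (digit_sum_ge _ q0); rewrite -pq.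
have h3 := three_pow_lower R; have h2 := two_pow_lower R.
have h4 : 36 / 289 <= 4 `^ (- p).
  rewrite (_ : 4 = 2 * 2); last by clear; lra.
  rewrite powRM// (_ : 36 / 289 = 6 / 17 * (6 / 17)); last by clear; lra.
  by apply: (ler_pM _ _ h2 h2); clear; lra.
have h4q : 4 `^ (- q) = 4 * 4 `^ (- p).
  by rewrite pq powRB1// mulrC divfK.
apply: (@le_trans _ _ (24 / 125 * (1 + 6 / 17 + 24 / 125 +
  (4 * (36 / 289) - 1 / 5000) / q + 36 / 289 / 2))).
  by rewrite qE; clear; lra.
apply: (ler_pM _ _ h3); first by clear; lra.
  by rewrite qE; clear; lra.
apply: lerD; last by rewrite ler_pM2r ?invr_gt0.
apply: lerD; first by apply: (lerD _ h3); rewrite lerD2l.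
by rewrite h4q ler_pM2r ?invr_gt0//; apply: lerB hN; rewrite ler_pM2l.
Qed.

(** The number of digits only has to be large enough for the tail of a convergent
    series to be negligible; it is not made explicit. *)
Lemma transfer_expands (R : realType) : exists N, forall x : R, `|x| <= 2 / 5 ->
  1001 / 1000 * parabola (17 / 200) x <=
  transfer (3 / 2 + 3 / 2000) (parabola (17 / 200)) N.+1 x.
Proof.
have [N hN] := digit_sum_lower R; exists N.+1 => x x25.
set p : R := 3 / 2 + 3 / 2000 in hN *.
have p0 : 0 <= p by rewrite /p; clear; lra.
have c0 : 0 <= 17 / 200 :> R by clear; lra.
apply: le_trans (transfer_ge_digit_sum N p0 c0 x25).
have h3 := three_pow_lower R; have h2 := two_pow_lower R.
set W := _ * (1 + _).
have hW : 29 / 1250 <= W.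
  rewrite /W !(pow_shift _ 2)//.
  apply: (@le_trans _ _ (24 / 125 / 3 ^+ 2 * (1 + 6 / 17 / 2 ^+ 2))).
    by clear; lra.
  apply: ler_pM; try by clear; lra.
    by rewrite ler_pM2r// invr_gt0 exprn_gt0.
  by rewrite lerD2l ler_pM2r// invr_gt0 exprn_gt0.
have pp : 375 / 100 <= p * (p + 1) by rewrite /p; clear; lra.
have x2 := sqr_ge0 x.
have h : 375 / 100 * (29 / 1250) <= p * (p + 1) * W.
  by apply: (ler_pM _ _ pp hW); clear; lra.
have h' := ler_wpM2r x2 h.
rewrite /parabola; clear - hN hW h' x2; lra.
Qed.

(** * Words of digits *)

Section Words.
Variable R : realType.
Implicit Types (x y : R) (l : letter) (w : seq letter).

Definition branch l x : R := - (digit R l + x)^-1.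

Definition cfrac w x : R := foldr branch x w.

(** The derivative of [cfrac w] at [x] is the inverse of the square of
    [denom w x]. *)
Fixpoint denom w x : R :=
  if w is l :: w' then denom w' x * (digit R l + cfrac w' x) else 1.

Lemma digit_norm l : 3 <= `|digit R l|.
Proof.
have h (n : nat) : 3 <= `|3 * n.+1%:R| :> R.
  by rewrite ger0_norm ?mulr_ge0// ler_peMr// ler1n.
by rewrite /digit; case: ifP => _; rewrite ?normrN.
Qed.

Lemma digit_add_norm l x : 3 - `|x| <= `|digit R l + x|.
Proof.
have := digit_norm l; have := lerB_dist (digit R l) (- x).
by rewrite opprK normrN; lra.
Qed.

Lemma branch_norm l x (r : R) : r < 3 -> `|x| <= r -> `|branch l x| <= (3 - r)^-1.
Proof.
move=> r3 xr; rewrite normrN normfV lef_pV2 ?posrE ?subr_gt0//.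
  by apply: le_trans (digit_add_norm l x); lra.
by apply: lt_le_trans (digit_add_norm l x); lra.
Qed.

Lemma cfrac_norm1 w x : `|x| <= 1 -> `|cfrac w x| <= 1.
Proof.
move=> x1; elim: w => //= l w IH; apply: le_trans (branch_norm l _ IH) _; first lra.
by rewrite -[leRHS]invr1 lef_pV2 ?posrE; lra.
Qed.

Lemma cfrac_norm w x : `|x| <= 2 / 5 -> `|cfrac w x| <= 2 / 5.
Proof.
move=> x1; elim: w => //= l w IH; apply: le_trans (branch_norm l _ IH) _; first lra.
by rewrite -[leRHS]invrK lef_pV2 ?posrE; lra.
Qed.

Lemma digit_add_neq0 l x : `|x| <= 1 -> digit R l + x != 0.
Proof.
move=> x1; rewrite -normr_gt0; apply: lt_le_trans (digit_add_norm l x) => //.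
by lra.
Qed.

Lemma denom_neq0 w x : `|x| <= 1 -> denom w x != 0.
Proof.
move=> x1; elim: w => [|l w IH] /=; first exact: oner_neq0.
by rewrite mulf_neq0// digit_add_neq0// cfrac_norm1.
Qed.

(** The difference formula of a Moebius transformation of determinant 1. *)
Lemma cfracB w x y : `|x| <= 1 -> `|y| <= 1 ->
  cfrac w x - cfrac w y = (x - y) / (denom w x * denom w y).
Proof.
move=> x1 y1; elim: w => [|l w IH] /=; first by rewrite mulr1 divr1.
have nx := digit_add_neq0 l (cfrac_norm1 w x1).
have ny := digit_add_neq0 l (cfrac_norm1 w y1).
have dx := denom_neq0 w x1; have dy := denom_neq0 w y1.
rewrite /branch (_ : _ - _ = (cfrac w x - cfrac w y) /
  ((digit R l + cfrac w x) * (digit R l + cfrac w y))); last by field; rewrite nx ny.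
by rewrite IH; field; rewrite nx ny dx dy.
Qed.

(** Numerator and denominator of a Moebius transformation are affine; they are
    carried along together in the induction. *)
Lemma denom_affine w : exists a b c d : R, forall x, `|x| <= 1 ->
  denom w x = c * x + d /\ cfrac w x * denom w x = a * x + b.
Proof.
elim: w => [|l w [a [b [c [d IH]]]]] /=.
  by exists 1, 0, 0, 1 => x _; split; ring.
exists (- c), (- d), (a + digit R l * c), (b + digit R l * d) => x x1.
have [e1 e2] := IH x x1.
have nx := digit_add_neq0 l (cfrac_norm1 w x1).
split.
  by rewrite mulrDr [_ * cfrac _ _]mulrC e2 e1; ring.
rewrite /branch [_ * (digit R l + _)]mulrC mulrA mulNr mulVf// mulN1r e1; ring.
Qed.

(** The denominator is an affine function without zero on [-1, 1], hence nearly
    constant on the smaller interval [-2/5, 2/5]. *)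
Lemma denom_distortion w x : `|x| <= 2 / 5 ->
  3 / 5 * `|denom w 0| <= `|denom w x| <= 7 / 5 * `|denom w 0|.
Proof.
move=> x25; have [a [b [c [d h]]]] := denom_affine w.
have x1 : `|x| <= 1 by lra.
have z1 : `|0 : R| <= 1 by rewrite normr0.
rewrite (h _ x1).1 (h _ z1).1 mulr0 add0r.
have cd : `|c| <= `|d|.
  rewrite leNgt; apply/negP => dc.
  have c0 : c != 0 by rewrite -normr_gt0; apply: le_lt_trans dc.
  have r1 : `|- (d / c)| <= 1.
    by rewrite normrN normf_div ler_pdivrMr ?normr_gt0// mul1r ltW.
  have := denom_neq0 w r1; rewrite (h _ r1).1 => /negP; apply.
  by apply/eqP; field.
have cx : `|c * x| <= 2 / 5 * `|d|.
  by rewrite normrM mulrC ler_pM.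
have := ler_normD (c * x) d; have := lerB_dist d (- (c * x)).
rewrite normrN opprK addrC (addrC d).
by move=> h1 h2; apply/andP; split; lra.
Qed.

Lemma denom_gt0 w x : `|x| <= 2 / 5 -> 0 < `|denom w x|.
Proof. by move=> h; rewrite normr_gt0 denom_neq0//; lra. Qed.

Lemma cfrac_contraction w x y : `|x| <= 2 / 5 -> `|y| <= 2 / 5 ->
  `|cfrac w x - cfrac w y| <= `|x - y| / (9 / 25 * `|denom w 0| ^+ 2).
Proof.
move=> x25 y25; rewrite cfracB; [|lra|lra].
have d0 : 0 < `|denom w 0| by rewrite denom_gt0// normr0; lra.
have /andP[dx _] := denom_distortion w x25; have /andP[dy _] := denom_distortion w y25.
rewrite normf_div ler_wpM2l// normrM lef_pV2 ?posrE.
- rewrite (_ : 9 / 25 * _ = 3 / 5 * `|denom w 0| * (3 / 5 * `|denom w 0|)).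
    by rewrite ler_pM//; lra.
  by field.
- by rewrite mulr_gt0// denom_gt0.
- by rewrite mulr_gt0// ?exprn_gt0//; lra.
Qed.

Lemma cfrac_expansion w x y : `|x| <= 2 / 5 -> `|y| <= 2 / 5 ->
  `|x - y| / (49 / 25 * `|denom w 0| ^+ 2) <= `|cfrac w x - cfrac w y|.
Proof.
move=> x25 y25; rewrite cfracB; [|lra|lra].
have d0 : 0 < `|denom w 0| by rewrite denom_gt0// normr0; lra.
have /andP[_ dx] := denom_distortion w x25; have /andP[_ dy] := denom_distortion w y25.
rewrite normf_div ler_wpM2l// normrM lef_pV2 ?posrE.
- rewrite (_ : 49 / 25 * _ = 7 / 5 * `|denom w 0| * (7 / 5 * `|denom w 0|)).
    by rewrite ler_pM//; lra.
  by field.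
- by rewrite mulr_gt0// ?exprn_gt0//; lra.
- by rewrite mulr_gt0// denom_gt0.
Qed.

Fixpoint words N m : seq (seq letter) :=
  if m is m'.+1 then [seq l :: w | l <- letters N, w <- words N m'] else [:: [::]].

(** The iterates of the transfer operator, written as sums over words. *)
Definition word_sum p (f : R -> R) N m x : R :=
  \sum_(w <- words N m) `|denom w x| `^ (- p) * f (cfrac w x).

Lemma word_sumS p f N m x : word_sum p f N m.+1 x =
  \sum_(w <- words N m) `|denom w x| `^ (- p) * transfer p f N (cfrac w x).
Proof.
rewrite /word_sum /= big_allpairs_dep exchange_big/=; apply: eq_bigr => w _.
rewrite /transfer mulr_sumr; apply: eq_bigr => l _.
by rewrite normrM powRM// mulrA.
Qed.

Lemma word_sum_le p f (rho : R) N m x : 0 <= rho ->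
  (forall y, `|y| <= 2 / 5 -> transfer p f N y <= rho * f y) ->
  `|x| <= 2 / 5 -> word_sum p f N m x <= rho ^+ m * f x.
Proof.
move=> r0 h x25; elim: m => [|m IH].
  by rewrite /word_sum /= big_seq1 /= normr1 powR1 !mul1r.
rewrite word_sumS exprS -mulrA; apply: le_trans (ler_wpM2l r0 IH).
rewrite /word_sum mulr_sumr; apply: ler_sum => w _.
by rewrite mulrCA ler_wpM2l ?powR_ge0// h// cfrac_norm.
Qed.

Lemma word_sum_ge p f (rho : R) N m x : 0 <= rho ->
  (forall y, `|y| <= 2 / 5 -> rho * f y <= transfer p f N y) ->
  `|x| <= 2 / 5 -> rho ^+ m * f x <= word_sum p f N m x.
Proof.
move=> r0 h x25; elim: m => [|m IH].
  by rewrite /word_sum /= big_seq1 /= normr1 powR1 !mul1r.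
rewrite word_sumS exprS -mulrA; apply: (le_trans (ler_wpM2l r0 IH)).
rewrite /word_sum mulr_sumr; apply: ler_sum => w _.
by rewrite mulrCA ler_wpM2l ?powR_ge0// h// cfrac_norm.
Qed.

Lemma mem_letters N l : (l \in letters N) = (l.2 < N)%N.
Proof.
case: l => b n /=; rewrite /letters; apply/idP/idP.
  by move=> /allpairsP[[b1 n1] /= [_ + [_ ->]]]; rewrite mem_iota add0n.
move=> nN; apply/allpairsP.
by exists (b, n); rewrite /= mem_iota add0n nN; split => //; case: b.
Qed.

Lemma letters_uniq N : uniq (letters N).
Proof. by apply: allpairs_uniq; rewrite ?iota_uniq// => -[? ?] [? ?]. Qed.

Lemma mem_words N m w :
  (w \in words N m) = (size w == m) && all (fun l : letter => (l.2 < N)%N) w.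
Proof.
elim: m w => [|m IH] w; first by rewrite inE; case: w.
case: w => [|l w]; first by apply/negP => /allpairsP[[? ?] /= [_ _]].
apply/idP/idP => [/allpairsP[[l' w'] /= [h1 h2 e]]|].
  move: e h1 h2 => [-> ->]; rewrite mem_letters IH => -> /andP[/eqP -> ->].
  by rewrite eqxx.
move=> /= /andP[]; rewrite eqSS => sw /andP[lN aw]; apply/allpairsP.
by exists (l, w); rewrite /= mem_letters IH sw lN aw.
Qed.

Lemma words_uniq N m : uniq (words N m).
Proof.
elim: m => //= m IH; apply: allpairs_uniq; rewrite ?letters_uniq//.
by move=> [? ?] [? ?] _ _ /= [-> ->].
Qed.

End Words.

(** * Cusps and the core of the limit set *)

Section Cusps.
Variable R : realType.
Implicit Types (x y : R) (l : letter) (w : seq letter) (k : int).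

(** The finite orbit points of infinity: the values of the finite continued
    fractions with digits in 3Z, of which only the leading one may be zero. *)
Definition cusps : set R := [set x | exists k w, x = 3 * k%:~R + cfrac w 0].

Lemma digit_int l : exists2 k, k != 0 & digit R l = 3 * k%:~R.
Proof.
case: l => -[] n; rewrite /digit/=.
  by exists (- n.+1%:Z) => //; rewrite mulrNz mulrN.
by exists n.+1%:Z.
Qed.

Lemma int_digit k : k != 0 -> exists l, digit R l = 3 * k%:~R.
Proof.
case: k => [[|n]|n] // _; first by exists (false, n).
by exists (true, n); rewrite /digit/= NegzE mulrNz mulrN.
Qed.

Lemma cusps0 : cusps 0.
Proof. by exists 0, [::]; rewrite /= mulr0 addr0. Qed.

Lemma cusps_shift k x : cusps x -> cusps (x + 3 * k%:~R).
Proof. by move=> [j [w ->]]; exists (j + k), w; rewrite intrD; ring. Qed.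

Lemma norm0_le : `|0 : R| <= 2 / 5. Proof. by rewrite normr0; lra. Qed.

Lemma cusps_inv x : cusps x -> x != 0 -> cusps (- x^-1).
Proof.
move=> [k [w ->]]; have [->|/int_digit[l <-] _] := eqVneq k 0; last first.
  by exists 0, (l :: w); rewrite mulr0 add0r.
rewrite mulr0 add0r; case: w => [|l w /= _]; first by rewrite /= eqxx.
have [k' _ e] := digit_int l; exists k', w.
by rewrite -e /branch invrN invrK opprK.
Qed.

Lemma cusps_near_multiple x : cusps x -> exists k, `|x - 3 * k%:~R| <= 2 / 5.
Proof. by move=> [k [w ->]]; exists k; rewrite addrC addKr cfrac_norm// norm0_le. Qed.

Lemma closure_ballP (A : set R) x :
  closure A x <-> forall e, 0 < e -> exists2 y, A y & `|x - y| < e.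
Proof.
split=> [cA e e0|h B /nbhs_ballP[e /= e0 eB]].
  by have [y [Ay xy]] := cA _ (nbhsx_ballx x e e0); exists y.
by have [y Ay xy] := h e e0; exists y; split => //; exact: eB.
Qed.

Lemma closure_cusps_shift k x :
  closure cusps x -> closure cusps (x + 3 * k%:~R).
Proof.
move=> /closure_ballP h; apply/closure_ballP => e e0.
have [y cy xy] := h e e0; exists (y + 3 * k%:~R); first exact: cusps_shift.
by rewrite (_ : _ - _ = x - y)//; ring.
Qed.

Lemma inv_lipschitz (x y e : R) : x != 0 -> `|x - y| < `|x| / 2 ->
  `|x - y| < e * (x ^+ 2 / 2) -> y != 0 /\ `|- x^-1 - (- y^-1)| < e.
Proof.
move=> x0 h1 h2.
have hx : 0 < `|x| by rewrite normr_gt0.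
have hy : `|x| / 2 < `|y|.
  by have := lerB_dist x (x - y); rewrite (_ : x - (x - y) = y); [lra|ring].
have y0 : y != 0 by rewrite -normr_gt0; lra.
have e0 : 0 < e.
  have : 0 < e * (x ^+ 2 / 2) by apply: le_lt_trans h2.
  by rewrite pmulr_lgt0// divr_gt0// exprn_even_gt0.
split=> //; rewrite (_ : _ - _ = (x - y) / (x * y)); last by field; rewrite x0 y0.
rewrite normf_div ltr_pdivrMr ?normr_gt0 ?mulf_neq0//; apply: lt_le_trans h2 _.
rewrite ler_wpM2l ?(ltW e0)// normrM -(real_normK (num_real x)) expr2 -mulrA.
by rewrite ler_wpM2l// ltW.
Qed.

Lemma closure_cusps_inv x : closure cusps x -> x != 0 -> closure cusps (- x^-1).
Proof.
move=> /closure_ballP h x0; apply/closure_ballP => e e0.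
have hx : 0 < `|x| by rewrite normr_gt0.
have m0 : 0 < Num.min (`|x| / 2) (e * (x ^+ 2 / 2)).
  by rewrite lt_min !divr_gt0// mulr_gt0// divr_gt0// exprn_even_gt0.
have [y cy] := h _ m0; rewrite lt_min => /andP[h1 h2].
have [y0 xy] := inv_lipschitz x0 h1 h2.
by exists (- y^-1) => //; exact: cusps_inv.
Qed.

Lemma int_dist_lt1 (j k : int) : `|j%:~R - k%:~R| < 1 :> R -> j = k.
Proof.
rewrite -intrB -intr_norm -[1]/(1%:~R) ltr_int => h.
by lia.
Qed.

(** The intervals of radius 2/5 around the multiples of 3 are far apart, so their
    union is closed; an approximation within 1/10 already determines which one
    contains the point. *)
Lemma closure_cusps_near_multiple x :
  closure cusps x -> exists k, `|x - 3 * k%:~R| <= 2 / 5.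
Proof.
move=> /closure_ballP h.
have [y cy xy] := h (1 / 10) ltac:(lra).
have [k hk] := cusps_near_multiple cy.
exists k; apply/ler_addgt0Pr => e e0.
have m0 : 0 < Num.min e (1 / 10) by rewrite lt_min e0; lra.
have [y' cy'] := h _ m0; rewrite lt_min => /andP[h1 h2].
have [k' hk'] := cusps_near_multiple cy'.
have kk : k = k'.
  apply: int_dist_lt1.
  move: hk hk' xy h2; rewrite !ler_norml !ltr_norml.
  by move=> /andP[? ?] /andP[? ?] /andP[? ?] /andP[? ?]; apply/andP; split; lra.
have := ler_normD (x - y') (y' - 3 * k%:~R).
rewrite kk (_ : x - y' + _ = x - 3 * k'%:~R); last by ring.
by lra.
Qed.

(** The part of the limit set around the origin, which is the limit set of the
    iterated function system of the maps [branch l]. *)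
Definition core : set R := closure cusps `&` [set x | `|x| <= 2 / 5].

Lemma core0 : core 0.
Proof. by split; [exact: subset_closure cusps0|exact: norm0_le]. Qed.

Lemma core_branch l x : core x -> core (branch l x).
Proof.
move=> [cx /= x25]; have [k _ e] := digit_int l; split => /=.
  apply: closure_cusps_inv; first by rewrite e addrC; exact: closure_cusps_shift.
  by apply: digit_add_neq0; lra.
exact: (@cfrac_norm _ [:: l]).
Qed.

Lemma core_cfrac w x : core x -> core (cfrac w x).
Proof. by move=> cx; elim: w => //= l w IH; exact: core_branch. Qed.

Lemma closure_cusps_core x : closure cusps x ->
  core x \/ (x != 0 /\ core (- x^-1)).
Proof.
move=> cx; have [k hk] := closure_cusps_near_multiple cx.
have [k0|/int_digit[l e]] := eqVneq k 0.
  by left; split => //; move: hk; rewrite k0 mulr0 subr0.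
right.
have cy : core (x - 3 * k%:~R).
  split => //; have := @closure_cusps_shift (- k) _ cx.
  by rewrite mulrNz mulrN.
have x25 : 2 / 5 < `|x|.
  have := digit_add_norm l (- (3 * k%:~R - x)); rewrite e.
  rewrite (_ : 3 * k%:~R + - (3 * k%:~R - x) = x); last by ring.
  by rewrite normrN distrC; lra.
have x0 : x != 0 by rewrite -normr_gt0; lra.
split=> //; have := core_branch l cy.
by rewrite /branch e (_ : 3 * _ + _ = x)//; ring.
Qed.

Lemma core_step x : core x -> x != 0 -> exists l y, core y /\ x = branch l y.
Proof.
move=> [cx /= x25] x0.
have cy := closure_cusps_inv cx x0.
have [k hk] := closure_cusps_near_multiple cy.
have [k0|/int_digit[l e]] := eqVneq k 0.
  move: hk; rewrite k0 mulr0 subr0 normrN normfV => hk; exfalso.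
  have hx : 0 < `|x| by rewrite normr_gt0.
  by move: hk; rewrite -[_^-1]mul1r ler_pdivrMr//; lra.
exists l, (- x^-1 - 3 * k%:~R); split.
  by split => //; have := @closure_cusps_shift (- k) _ cy; rewrite mulrNz mulrN.
by rewrite /branch e addrC subrK invrN invrK opprK.
Qed.

(** The expansion of a point of the core either stops, which happens at countably
    many points, or can be continued to any length. *)
Lemma core_words m x : core x -> exists w,
  ((size w < m)%N /\ x = cfrac w 0) \/
  (size w = m /\ exists2 y, core y & x = cfrac w y).
Proof.
elim: m x => [|m IH] x cx; first by exists [::]; right; split => //; exists x.
have [->|x0] := eqVneq x 0; first by exists [::]; left.
have [l [y [cy ->]]] := core_step cx x0.
have [w [[sw ->]|[sw [z cz ->]]]] := IH y cy.
  by exists (l :: w); left.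
by exists (l :: w); right; rewrite /= sw; split => //; exists z.
Qed.

End Cusps.

Local Open Scope complex_scope.

(** * The chordal metric *)

Section Chordal.
Variable R : realType.
Implicit Types (z : R[i]) (x y : R).

Lemma normc_ge0 z : 0 <= normc z.
Proof. by case: z => a b; rewrite sqrtr_ge0. Qed.

Lemma normc_real x : normc x%:C = `|x|.
Proof. by rewrite /= expr0n addr0 sqrtr_sqr. Qed.

Lemma normc_Re z : `|complex.Re z| <= normc z.
Proof. by case: z => a b /=; rewrite -sqrtr_sqr ler_sqrt ?lerDl ?sqr_ge0// addr_ge0 ?sqr_ge0. Qed.

Lemma normc_Im z : `|complex.Im z| <= normc z.
Proof. by case: z => a b /=; rewrite -sqrtr_sqr ler_sqrt ?lerDr ?sqr_ge0// addr_ge0 ?sqr_ge0. Qed.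

Lemma sqrt1D_ge1 (a : R) : 0 <= a -> 1 <= Num.sqrt (1 + a).
Proof. by move=> a0; rewrite -[leLHS]sqrtr1 ler_sqrt ?lerDl// addr_ge0. Qed.

Lemma sqrt1D_ge (a : R) : 0 <= a -> a <= Num.sqrt (1 + a ^+ 2).
Proof.
by move=> a0; rewrite -[leLHS]ger0_norm// -sqrtr_sqr ler_sqrt ?lerDr// addr_ge0 ?sqr_ge0.
Qed.

Lemma sqrt1D_le (a : R) : 0 <= a -> Num.sqrt (1 + a ^+ 2) <= 1 + a.
Proof.
move=> a0; rewrite -[leRHS]ger0_norm ?addr_ge0// -sqrtr_sqr ler_sqrt ?sqr_ge0//.
by rewrite sqrrD expr1n mul1r lerD2r lerDl mulrn_wge0.
Qed.

Lemma chordal_le z z' : chordal (Some z) (Some z') <= 2 * normc (z - z').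
Proof.
have h1 := sqrt1D_ge1 (sqr_ge0 (normc z)); have h2 := sqrt1D_ge1 (sqr_ge0 (normc z')).
rewrite /= ler_pdivrMr; last by rewrite mulr_gt0//; lra.
rewrite ler_peMr ?mulr_ge0 ?normc_ge0//.
by rewrite -[leLHS]mul1r ler_pM.
Qed.

(** Chordal balls around a finite point are small in the Euclidean sense; the
    factor [1 + normc z] bounds the distortion of the stereographic projection. *)
Lemma chordal_close z (e : R) : 0 < e -> exists2 r, 0 < r &
  forall z', chordal (Some z) (Some z') < r -> normc (z' - z) < e.
Proof.
move=> e0; set B := 1 + normc z.
have B0 : 0 < B by rewrite ltr_pwDl// normc_ge0.
have r0 : 0 < Num.min B^-1 (e / B ^+ 2).
  by rewrite lt_min invr_gt0 B0 divr_gt0// exprn_gt0.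
exists (Num.min B^-1 (e / B ^+ 2)) => // z' /=; rewrite lt_min => /andP[].
rewrite -normcN opprB; set t := normc (z' - z).
have t0 : 0 <= t := normc_ge0 _.
have z'B : normc z' <= normc z + t.
  by apply: le_trans (le_normcD _ _); rewrite addrC subrK.
set s := Num.sqrt _ * Num.sqrt _ => h1 h2.
have s0 : 0 < s.
  by rewrite mulr_gt0// (lt_le_trans _ (sqrt1D_ge1 (sqr_ge0 _))).
have sB : s <= B * (B + t).
  rewrite ler_pM ?sqrtr_ge0 ?sqrt1D_le ?normc_ge0//.
  by apply: le_trans (sqrt1D_le (normc_ge0 _)) _; rewrite /B -addrA lerD2l.
have h1' : 2 * t < B + t.
  rewrite ltr_pdivrMr// in h1; apply: lt_le_trans h1 _.
  by rewrite mulrC ler_pdivrMr// mulrC.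
have h2' : 2 * t < e / B * (B + t).
  rewrite ltr_pdivrMr// in h2; apply: lt_le_trans h2 _.
  rewrite (_ : e / B * _ = e / B ^+ 2 * (B * (B + t))); last by field; rewrite gt_eqF.
  by rewrite ler_wpM2l// divr_ge0 ?ltW// exprn_gt0.
have tB : t < B by lra.
have : 2 * t < e / B * (B + B).
  by apply: lt_trans h2' _; rewrite ltr_pM2l ?divr_gt0// ltrD2l.
by rewrite (_ : e / B * _ = 2 * e) ?ltr_pM2l//; field; rewrite gt_eqF.
Qed.

Lemma chordal_real_ge x y : `|x| <= 2 / 5 -> `|y| <= 2 / 5 ->
  `|x - y| <= chordal (Some x%:C) (Some y%:C).
Proof.
move=> x25 y25; rewrite /chordal -rmorphB !normc_real !real_normK ?num_real//.
have h (a : R) : `|a| <= 2 / 5 -> 0 < Num.sqrt (1 + a ^+ 2) <= 7 / 5.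
  move=> ha; rewrite (lt_le_trans _ (sqrt1D_ge1 (sqr_ge0 _)))//=.
  by rewrite -(real_normK (num_real a)); apply: le_trans (sqrt1D_le (normr_ge0 _)) _; lra.
have /andP[a0 a1] := h _ x25; have /andP[b0 b1] := h _ y25.
rewrite ler_pdivlMr ?mulr_gt0// mulrC ler_wpM2r//.
apply: (@le_trans _ _ (7 / 5 * (7 / 5))); last by lra.
by apply: ler_pM => //; exact: ltW.
Qed.

(** The extension of the map S to the real line with values in the sphere. *)
Definition inv_point x : riemann_sphere R :=
  if x == 0 then None else Some (- x^-1)%:C.

(** Since S is an isometry of the sphere, this is the same bound as in
    [chordal_le]. *)
Lemma chordal_inv_point x y : chordal (inv_point x) (inv_point y) <= 2 * `|x - y|.
Proof.
have h (a : R) : a != 0 -> 0 < `|a^-1| <= Num.sqrt (1 + a^-1 ^+ 2).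
  move=> a0; rewrite normr_gt0 invr_neq0//=.
  by apply: le_trans (sqrt1D_ge (normr_ge0 a^-1)) _; rewrite real_normK ?num_real.
have key (a : R) : a != 0 -> (Num.sqrt (1 + a^-1 ^+ 2))^-1 <= `|a|.
  move=> a0; have /andP[i0 hi] := h a a0.
  by rewrite -[leRHS]invrK -normfV lef_pV2 ?posrE// (lt_le_trans i0).
have nN (a : R) : normc (- a^-1)%:C ^+ 2 = a^-1 ^+ 2.
  by rewrite normc_real normrN real_normK ?num_real.
rewrite /inv_point; case: eqVneq => [->|x0]; case: eqVneq => [->|y0].
- by rewrite /chordal subrr normr0 mulr0.
- by rewrite /chordal nN sub0r normrN ler_wpM2l// key.
- by rewrite /chordal nN subr0 ler_wpM2l// key.
rewrite /chordal !nN -rmorphB normc_real.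
rewrite (_ : - x^-1 - - y^-1 = (x - y) * (x^-1 * y^-1)); last by field; rewrite x0 y0.
rewrite invfM !normrM -!mulrA ler_wpM2l//.
rewrite -[leRHS]mulr1 ler_wpM2l//.
set s := (Num.sqrt (1 + x^-1 ^+ 2))^-1; set t := (Num.sqrt (1 + y^-1 ^+ 2))^-1.
rewrite [leLHS](_ : _ = `|x^-1| * s * (`|y^-1| * t)); last by ring.
have one (a : R) : a != 0 -> 0 <= `|a^-1| * (Num.sqrt (1 + a^-1 ^+ 2))^-1 <= 1.
  move=> a0; have /andP[i0 hi] := h a a0.
  by rewrite mulr_ge0 ?invr_ge0 ?sqrtr_ge0//= ler_pdivrMr ?mul1r// (lt_le_trans i0).
have /andP[lx ux] := one x x0; have /andP[ly uy] := one y y0.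
by rewrite -[leRHS]mul1r; apply: ler_pM.
Qed.

End Chordal.

(** * The group as a group of integer matrices *)

Section Group.
Variable R : realType.
Implicit Types (a b c d : int) (p q x y : R).
Let H := upper_half_plane R.

(** [p : q] are homogeneous coordinates of a point of the orbit of infinity. *)
Definition projective_cusp p q : Prop := q = 0 \/ cusps (p / q).

Definition moebius_by a b c d (f : H -> H) : Prop := forall z : H,
  val (f z) * (c%:~R * val z + d%:~R) = a%:~R * val z + b%:~R.

(** The elements of the group are represented by integer matrices of
    determinant 1 that permute the cusps. *)
Definition cusp_moebius : set (H -> H) := [set f | exists a b c d,
  [/\ a * d - b * c = 1, moebius_by a b c d f &
   forall p q, projective_cusp (a%:~R * p + b%:~R * q) (c%:~R * p + d%:~R * q)
     <-> projective_cusp p q]].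

(** In homogeneous coordinates S and T act on the cusps without exceptional
    points. *)
Lemma projective_cusp_inv p q : projective_cusp p q -> projective_cusp (- q) p.
Proof.
move=> [->|h]; first by right; rewrite oppr0 mul0r; exact: cusps0.
have [->|p0] := eqVneq p 0; first by left.
have [->|q0] := eqVneq q 0; first by right; rewrite oppr0 mul0r; exact: cusps0.
right; have := cusps_inv h; rewrite invf_div -mulNr; apply.
by rewrite mulf_neq0// invr_neq0.
Qed.

Lemma projective_cusp_neg p q : projective_cusp (- p) (- q) <-> projective_cusp p q.
Proof.
rewrite /projective_cusp invrN mulrNN; split=> -[h|h]; [left|right|left|right] => //.
  by rewrite -[q]opprK h oppr0.
by rewrite h oppr0.
Qed.

Lemma projective_cusp_shift (k : int) p q :
  projective_cusp p q -> projective_cusp (p + 3 * k%:~R * q) q.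
Proof.
move=> [->|h]; first by left.
have [->|q0] := eqVneq q 0; first by left.
by right; rewrite mulrDl mulfK//; exact: cusps_shift.
Qed.

Lemma val_neq0 (z : H) : val z != 0.
Proof. by case: z => -[u v] /= v0; rewrite eq_complex /= negb_and (gt_eqF v0) orbT. Qed.

Lemma cusp_moebiusS : cusp_moebius (@moebiusS R).
Proof.
exists 0, (-1), 1, 0; split => //.
  move=> z; rewrite /= mulr0z addr0 mul1r mul0r add0r mulNr mulVf ?val_neq0//.
move=> p q; rewrite !mul0r add0r addr0 mulN1r mul1r; split.
  by move=> /projective_cusp_inv /projective_cusp_neg.
exact: projective_cusp_inv.
Qed.

Lemma cusp_moebiusT : cusp_moebius (moebiusT 3).
Proof.
exists 1, 3, 0, 1; split => //.
  by move=> z; rewrite /= mul0r add0r mulr1 mul1r (rmorph_nat (real_complex R) 3).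
move=> p q; rewrite mul1r mul0r add0r mul1r; split => h.
  have := projective_cusp_shift (- 1) h.
  by rewrite (_ : _ + 3 * (- 1)%:~R * q = p)//; ring.
by have := projective_cusp_shift 1 h; rewrite mulr1.
Qed.

Lemma cusp_moebius_group : transformation_group cusp_moebius.
Proof.
split.
- exists 1, 0, 0, 1; split => //.
    by move=> z; rewrite /= mul0r add0r mulr1 mul1r addr0.
  by move=> p q; rewrite !mul1r !mul0r addr0 add0r.
- move=> f g [a [b [c [d [e1 m1 c1]]]]] [a' [b' [c' [d' [e2 m2 c2]]]]].
  exists (a * a' + b * c'), (a * b' + b * d'), (c * a' + d * c'), (c * b' + d * d').
  split.
  + rewrite (_ : _ - _ = (a * d - b * c) * (a' * d' - b' * c')); last by ring.
    by rewrite e1 e2.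
  + move=> z; have := m1 (g z); have := m2 z.
    rewrite !intrD !intrM -[(f \o g) z]/(f (g z)).
    move: (val (f (g z))) (val (g z)) (val z) => u v t h2 h1.
    transitivity (u * (c%:~R * v + d%:~R) * (c'%:~R * t + d'%:~R)
      + u * c%:~R * (a'%:~R * t + b'%:~R - v * (c'%:~R * t + d'%:~R))); first by ring.
    rewrite h1 h2 subrr mulr0 addr0.
    transitivity (a%:~R * (v * (c'%:~R * t + d'%:~R)) + b%:~R * (c'%:~R * t + d'%:~R)).
      by ring.
    by rewrite h2; ring.
  + move=> p q; rewrite !intrD !intrM.
    apply: iff_trans (c2 p q).
    apply: iff_trans (c1 (a'%:~R * p + b'%:~R * q) (c'%:~R * p + d'%:~R * q)).
    set u := (X in projective_cusp X _); set v := (X in projective_cusp _ X).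
    set u' := (X in _ <-> projective_cusp X _); set v' := (X in _ <-> projective_cusp _ X).
    have -> : u = u' by rewrite /u /u'; ring.
    by have -> : v = v' by rewrite /v /v'; ring.
- move=> f g [a [b [c [d [e1 m1 c1]]]]] fg gf.
  exists d, (- b), (- c), a; split.
  + by rewrite -e1; ring.
  + move=> z; have := m1 (g z); rewrite gf.
    move: (val z) (val (g z)) => t v h.
    rewrite !mulrNz; apply/eqP; rewrite -subr_eq0; apply/eqP.
    transitivity (a%:~R * v + b%:~R - t * (c%:~R * v + d%:~R)); first by ring.
    by rewrite h subrr.
  + move=> p q; rewrite !mulrNz.
    have e : a%:~R * d%:~R - b%:~R * c%:~R = 1 :> R by rewrite -!intrM -intrB e1.
    apply: iff_trans (iff_sym (c1 _ _)) _.
    set u := (X in projective_cusp X _); set v := (X in projective_cusp _ X).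
    have -> : u = p by rewrite -[RHS]mul1r -e /u; ring.
    by have -> : v = q by rewrite -[RHS]mul1r -e /v; ring.
Qed.

Lemma hecke_cusp_moebius : hecke_group 3 `<=` cusp_moebius.
Proof.
apply: smallest_sub; first exact: cusp_moebius_group.
by move=> f [->|->]; [exact: cusp_moebiusS|exact: cusp_moebiusT].
Qed.

End Group.

(** * Limit points lie in the closure of the cusps *)

Lemma finite_separation (R : realType) (T : metricType R) (p : T) (s : seq T) :
  exists2 r : R, 0 < r & forall q, q \in s -> q != p -> r <= mdist p q.
Proof.
elim: s => [|q s [r r0 h]]; first by exists 1.
have [->|qp] := eqVneq q p.
  by exists r => // q'; rewrite inE => /predU1P[->|/h//]; rewrite eqxx.
exists (Num.min r (mdist p q)); first by rewrite lt_min r0 mdist_gt0 eq_sym.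
move=> q'; rewrite inE => /predU1P[-> _|/h{}h /h{}h]; first by rewrite ge_min lexx orbT.
by rewrite ge_min h.
Qed.

Section LimitSet.
Variable R : realType.
Implicit Types (a b c d : int) (x y : R).
Let H := upper_half_plane R.

Lemma intC (k : int) : k%:~R = (k%:~R : R)%:C :> R[i].
Proof. by rewrite (rmorph_int (real_complex R)). Qed.

Lemma normc_int (k : int) : normc (k%:~R : R[i]) = `|k%:~R : R|.
Proof. by rewrite intC normc_real. Qed.

Lemma affine_norm_ge c d (z : R[i]) :
  `|c%:~R| * `|complex.Im z| <= normc (c%:~R * z + d%:~R).
Proof.
apply: le_trans (normc_Im _); rewrite !intC; case: z => u v.
by rewrite /= mul0r !addr0 normrM.
Qed.

Lemma affine_coef_bound c d (z : R[i]) (M : R) : 0 < complex.Im z ->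
  normc (c%:~R * z + d%:~R) <= M ->
  `|c%:~R| <= M / complex.Im z /\ `|d%:~R| <= M + M / complex.Im z * normc z.
Proof.
move=> y0 hM.
have hc : `|c%:~R| <= M / complex.Im z.
  rewrite ler_pdivlMr//; apply: le_trans hM.
  by apply: le_trans (affine_norm_ge c d z); rewrite (gtr0_norm y0).
split=> //; rewrite -normc_int.
rewrite (_ : d%:~R = (c%:~R * z + d%:~R) + - (c%:~R * z)); last by ring.
apply: le_trans (le_normcD _ _) _; rewrite normcN normcM normc_int.
by apply: lerD => //; rewrite ler_wpM2r ?normc_ge0.
Qed.

Lemma affine_neq0 a b c d (z : R[i]) : 0 < complex.Im z -> a * d - b * c = 1 ->
  c%:~R * z + d%:~R != 0.
Proof.
move=> y0 e; apply/eqP => h.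
have := @affine_coef_bound c d z 0 y0; rewrite h normc0 => /(_ (lexx _)).
rewrite !mul0r addr0 !normr_le0 !intr_eq0 => -[/eqP c0 /eqP d0].
by move: e; rewrite c0 d0 !mulr0 subr0.
Qed.

Definition int_range (B : nat) : seq int := [seq i%:Z - B%:Z | i <- iota 0 B.*2.+1].

Lemma mem_int_range (B : nat) (k : int) : (`|k| <= B)%N -> k \in int_range B.
Proof.
move=> kB; apply/mapP; exists (absz (k + B%:Z)); last by lia.
by rewrite mem_iota add0n; lia.
Qed.

Lemma moebius_val a b c d (f : H -> H) (z : H) : a * d - b * c = 1 ->
  moebius_by a b c d f ->
  val (f z) = (a%:~R * val z + b%:~R) / (c%:~R * val z + d%:~R).
Proof.
by move=> e m; rewrite -m mulfK//; apply: affine_neq0 e; exact: (valP z).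
Qed.

(** Since the matrices are integral, only finitely many orbit points are both
    bounded and attained with a bounded denominator; this is where the
    discreteness of the group enters. *)
Lemma finite_small_denominator (z : H) (M N : R) : 0 <= M -> 0 <= N ->
  exists s : seq R[i], forall a b c d (f : H -> H), a * d - b * c = 1 ->
    moebius_by a b c d f -> normc (c%:~R * val z + d%:~R) <= M ->
    normc (val (f z)) <= N -> val (f z) \in s.
Proof.
move=> M0 N0; have y0 : 0 < complex.Im (val z) := valP z.
set y := complex.Im (val z) in y0 *; set Q := M + N * M.
have Q0 : 0 <= Q by rewrite addr_ge0// mulr_ge0.
set X := Q + Q / y * normc (val z) + Q / y.
set B := (Num.truncn X).+1.
have boundP (k : int) : `|k%:~R| <= X -> k \in int_range B.
  move=> kX; apply: mem_int_range.
  have : `|k%:~R| < B%:R :> R by apply: le_lt_trans kX _; exact: truncnS_gt.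
  by rewrite -intr_norm -[B%:R]/((B%:Z)%:~R) ltr_int; lia.
have affineP c d : normc (c%:~R * val z + d%:~R) <= Q ->
    c \in int_range B /\ d \in int_range B.
  move=> /(affine_coef_bound y0)[hc hd].
  have P1 : 0 <= Q / y by rewrite divr_ge0// ltW.
  have P2 : 0 <= Q / y * normc (val z) by rewrite mulr_ge0 ?normc_ge0.
  by split; apply: boundP; rewrite /X /y; [apply: le_trans hc _|apply: le_trans hd _]; rewrite -/y; lra.
pose pairs := [seq (c, d) | c <- int_range B, d <- int_range B].
exists [seq (ab.1%:~R * val z + ab.2%:~R) / (cd.1%:~R * val z + cd.2%:~R)
  | ab <- pairs, cd <- pairs].
move=> a b c d f e m hM hN.
have [hc hd] : c \in int_range B /\ d \in int_range B.
  by apply: affineP; apply: le_trans hM _; rewrite lerDl mulr_ge0.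
have [ha hb] : a \in int_range B /\ b \in int_range B.
  apply: affineP; rewrite -m normcM.
  apply: (@le_trans _ _ (N * M)); last by rewrite lerDr.
  by rewrite ler_pM ?normc_ge0.
rewrite (moebius_val z e m); apply/allpairsP; exists ((a, b), (c, d)); split => //.
  by apply/allpairsP; exists (a, b).
by apply/allpairsP; exists (c, d).
Qed.

(** The finitely many orbit points with a small denominator stay at a positive
    distance from a limit point, unless they are equal to it. *)
Lemma limit_point_approx (z : H) (p : R[i]) (e : R) : 0 < e -> e < 1 ->
  limit_point (hecke_orbit 3 z) (Some p) ->
  exists a b c d (f : H -> H), [/\ a * d - b * c = 1, moebius_by a b c d f,
    (forall u v : R, projective_cusp (a%:~R * u + b%:~R * v) (c%:~R * u + d%:~R * v)
     <-> projective_cusp u v),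
    normc (val (f z) - p) < e & e^-1 < normc (c%:~R * val z + d%:~R)].
Proof.
move=> e0 e1 lp.
have [s hs] := @finite_small_denominator z e^-1 (1 + normc p) ltac:(by rewrite invr_ge0 ltW)
  ltac:(by rewrite addr_ge0 ?normc_ge0).
have [r r0 hr] := finite_separation (Some p : riemann_sphere R)
  (map (fun q => Some q : riemann_sphere R) s).
have [r' r'0 hr'] := chordal_close p e0.
have m0 : 0 < Num.min r r' by rewrite lt_min r0.
have [q [qp [f Gf fq]]] := lp _ (nbhsx_ballx (Some p : riemann_sphere R) _ m0).
rewrite ballEmdist /= => hq.
have [a [b [c [d [ed md cd]]]]] := hecke_cusp_moebius Gf.
exists a, b, c, d, f; split => //.
  by apply: hr'; move: hq; rewrite -fq lt_min => /andP[].
rewrite ltNge; apply/negP => hM.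
have close : normc (val (f z) - p) < e.
  by apply: hr'; move: hq; rewrite -fq lt_min => /andP[].
have : val (f z) \in s.
  apply: hs ed md hM _.
  rewrite (_ : val (f z) = (val (f z) - p) + p); last by rewrite subrK.
  by apply: le_trans (le_normcD _ _) _; rewrite lerD2r; lra.
move=> fs; have := hr q; rewrite -fq map_f// => /(_ isT).
rewrite fq => /(_ qp); move: hq; rewrite lt_min => /andP[h1 _].
by rewrite leNgt h1.
Qed.

(** For a group element with c nonzero, g z - a / c = - 1 / (c (c z + d)), and a / c
    is a cusp; both this difference and the distance of g z from the limit point
    are arbitrarily small. *)
Lemma limit_set_sub (p : riemann_sphere R) : limit_set 3 p ->
  p = None \/ exists2 x, closure (@cusps R) x & p = Some x%:C.
Proof.
case: p => [p|]; last by left.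
move=> [z _ lp]; right.
have key e : 0 < e -> e < 1 -> exists2 x, cusps x & normc (p - x%:C) < 2 * e.
  move=> e0 e1; have [a [b [c [d [f [ed md cd h1 h2]]]]]] := limit_point_approx e0 e1 lp.
  have ee : 1 < e^-1 by rewrite invf_gt1.
  have c0 : c != 0.
    apply/eqP => c0; move: h2 ed; rewrite c0 mul0r add0r mulr0 subr0 normc_int => h2 ad.
    have := congr1 absz ad; rewrite abszM => /eqP; rewrite muln_eq1 => /andP[_ /eqP dn].
    have d1 : `|d| = 1 by lia.
    by move: h2; rewrite -intr_norm d1; lra.
  have c1 : 1 <= `|c%:~R| :> R.
    by rewrite -intr_norm -[1]/(1%:~R) ler_int; lia.
  have cR : c%:~R != 0 :> R by rewrite intr_eq0.
  have cC : c%:~R != 0 :> R[i] by rewrite intr_eq0.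
  exists (a%:~R / c%:~R).
    have := (cd 1 0).2; rewrite !mulr1 !mulr0 !addr0 => /(_ (or_introl erefl)).
    by case=> // /eqP; rewrite (negbTE cR).
  have D0 : c%:~R * val z + d%:~R != 0 := affine_neq0 (valP z) ed.
  have ediff : val (f z) - (a%:~R / c%:~R)%:C = - (c%:~R * (c%:~R * val z + d%:~R))^-1.
    rewrite (moebius_val z ed md) rmorphM fmorphV /= -!intC.
    have eC : a%:~R * d%:~R - b%:~R * c%:~R = 1 :> R[i] by rewrite -!intrM -intrB ed.
    rewrite -[sval z]/(val z); move: D0 eC cC; move: (val z) (a%:~R : R[i]) (b%:~R : R[i]) (c%:~R : R[i]) (d%:~R : R[i]).
    move=> Z A B C D D0 eC cC.
    transitivity (- ((A * D - B * C) / (C * (C * Z + D)))).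
      by field; rewrite cC D0.
    by rewrite eC mul1r.
  have h3 : normc (val (f z) - (a%:~R / c%:~R)%:C) < e.
    rewrite ediff normcN normcV normcM normc_int.
    rewrite -[e]invrK ltf_pV2 ?posrE ?invr_gt0//; last first.
      by rewrite mulr_gt0//; lra.
    by apply: lt_le_trans h2 _; rewrite ler_peMl ?normc_ge0.
  rewrite (_ : p - _ = - (val (f z) - p) + (val (f z) - (a%:~R / c%:~R)%:C)); last by ring.
  by apply: le_lt_trans (le_normcD _ _) _; rewrite normcN; lra.
have im0 : complex.Im p = 0.
  apply/eqP; rewrite -normr_le0; apply/ler_addgt0Pr => e e0; rewrite add0r.
  have m0 : 0 < Num.min (e / 2) 2^-1 by rewrite lt_min divr_gt0//= invr_gt0.
  have m1 : Num.min (e / 2) 2^-1 < 1 by rewrite gt_min; apply/orP; right; lra.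
  have [x _ hx] := key _ m0 m1.
  have -> : complex.Im p = complex.Im (p - x%:C) by case: (p) => u v; rewrite /= subr0.
  apply: le_trans (normc_Im _) _; apply: le_trans (ltW hx) _.
  have : Num.min (e / 2) 2^-1 <= e / 2 by rewrite ge_min lexx.
  by lra.
exists (complex.Re p); last by case: (p) im0 => u v /= ->.
apply/closure_ballP => e e0.
have m0 : 0 < Num.min (e / 2) 2^-1 by rewrite lt_min divr_gt0//= invr_gt0.
have m1 : Num.min (e / 2) 2^-1 < 1 by rewrite gt_min; apply/orP; right; lra.
have [x cx hx] := key _ m0 m1; exists x => //.
have -> : complex.Re p - x = complex.Re (p - x%:C) by case: (p).
apply: le_lt_trans (normc_Re _) _; apply: lt_le_trans hx _.
have : Num.min (e / 2) 2^-1 <= e / 2 by rewrite ge_min lexx.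
by lra.
Qed.

End LimitSet.

(** * Cusps are limit points *)

Section CuspsAreLimits.
Variable R : realType.
Implicit Types (x y : R).
Let H := upper_half_plane R.

Lemma i_subproof : 0 < complex.Im ('i%C : R[i]).
Proof. exact: ltr01. Qed.

Definition base_point : H := exist _ 'i%C i_subproof.

(** The real points at which the orbit of i accumulates in the Euclidean sense. *)
Definition orbit_limit : set R := [set x | forall e, 0 < e ->
  exists2 g, hecke_group 3 g & normc (val (g base_point) - x%:C) < e].

Lemma hecke_transformation_group : transformation_group (@hecke_group R 3).
Proof.
split.
- by move=> G [[]].
- move=> f g hf hg G [tG sG]; have [_ G2 _] := tG.
  by apply: G2; [exact: (hf G)|exact: (hg G)].
- move=> f g hf fg gf G [tG sG]; have [_ _ G3] := tG.
  by apply: G3 fg gf; exact: (hf G).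
Qed.

Lemma heckeS : hecke_group 3 (@moebiusS R).
Proof. by move=> G [_ sG]; apply: sG => /=; left. Qed.

Lemma heckeT : hecke_group 3 (@moebiusT R 3).
Proof. by move=> G [_ sG]; apply: sG => /=; right. Qed.

Lemma heckeTN : hecke_group 3 (@moebiusT R (- 3)).
Proof.
have [_ _ h] := hecke_transformation_group; apply: h heckeT _ _ => z.
- apply: val_inj => /=.
  by rewrite rmorphN addrK.
- apply: val_inj => /=.
  by rewrite rmorphN subrK.
Qed.

Lemma hecke_comp f g : hecke_group 3 f -> hecke_group 3 g -> @hecke_group R 3 (f \o g).
Proof. by have [_ h _] := hecke_transformation_group; exact: h. Qed.

Lemma orbit_limit_shift (k : int) x : orbit_limit x -> orbit_limit (x + 3 * k%:~R).
Proof.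
have shift (t : R) : hecke_group 3 (@moebiusT R t) -> forall y, orbit_limit y -> orbit_limit (y + t).
  move=> ht y h e e0; have [g hg hy] := h e e0.
  exists (moebiusT t \o g); first exact: hecke_comp.
  rewrite -[val _]/(val (g base_point) + t%:C).
  have -> : (y + t)%:C = y%:C + t%:C by exact: (rmorphD (real_complex R)).
  by rewrite (_ : _ - _ = val (g base_point) - y%:C)//; ring.
move=> h; case: k => n.
  elim: n => [|n IH]; first by rewrite mulr0 addr0.
  have := shift 3 heckeT _ IH; congr orbit_limit.
  by rewrite intS intrD; ring.
elim: n => [|n IH].
  by have := shift _ heckeTN _ h; congr orbit_limit; rewrite NegzE mulrNz; ring.
have := shift _ heckeTN _ IH; congr orbit_limit.
by rewrite !NegzE !mulrNz [n.+2%:Z]intS intrD; ring.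
Qed.

Lemma orbit_limit_inv x : orbit_limit x -> x != 0 -> orbit_limit (- x^-1).
Proof.
move=> h x0 e e0.
have hx : 0 < `|x| by rewrite normr_gt0.
have m0 : 0 < Num.min (`|x| / 2) (e * (x ^+ 2 / 2)).
  by rewrite lt_min !divr_gt0// mulr_gt0// divr_gt0// exprn_even_gt0.
have [g hg] := h _ m0; rewrite lt_min => /andP[h1 h2].
exists (@moebiusS R \o g); first exact: hecke_comp heckeS hg.
rewrite -[val _]/(- (val (g base_point))^-1).
have z0 := val_neq0 (g base_point).
move: (val (g base_point)) h1 h2 z0 => z h1 h2 z0.
have xC : x%:C != 0 by rewrite eq_complex /= negb_and x0.
have hz : `|x| / 2 < normc z.
  have : normc x%:C <= normc z + normc (z - x%:C).
    have -> : normc x%:C = normc (z + - (z - x%:C)) by congr normc; ring.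
    by apply: le_trans (le_normcD _ _) _; rewrite normcN.
  by rewrite normc_real; lra.
rewrite (_ : (- x^-1)%:C = - (x%:C)^-1); last by rewrite rmorphN fmorphV.
rewrite (_ : _ - _ = (z - x%:C) / (x%:C * z)); last by field; rewrite xC z0.
rewrite normcM normcV normcM normc_real.
have p0 : 0 < `|x| * normc z by rewrite mulr_gt0//; lra.
rewrite ltr_pdivrMr//; apply: lt_le_trans h2 _.
rewrite ler_wpM2l ?(ltW e0)// -(real_normK (num_real x)) expr2 -mulrA.
by rewrite ler_wpM2l// ltW.
Qed.

(** S T^n i tends to 0. *)
Lemma orbit_limit0 : orbit_limit 0.
Proof.
move=> e e0.
pose n := (Num.truncn (e^-1)).+1.
have hT (m : nat) : exists2 g, hecke_group 3 g & val (g base_point) = 'i + (3 * m%:R)%:C.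
  elim: m => [|m [g hg hv]].
    exists id; last by rewrite mulr0 addr0.
    by have [] := hecke_transformation_group.
  exists (moebiusT 3 \o g); first exact: hecke_comp heckeT hg.
  by rewrite /= hv -addrA -rmorphD -natr1; congr (_ + _%:C); ring.
have [g hg hv] := hT n; exists (@moebiusS R \o g); first exact: hecke_comp heckeS hg.
rewrite -[val _]/(- (val (g base_point))^-1) hv subr0 normcN normcV.
have en : e^-1 < n%:R by exact: truncnS_gt.
have big : e^-1 < normc ('i + (3 * n%:R)%:C).
  apply: lt_le_trans (normc_Re _); rewrite /= add0r ger0_norm ?mulr_ge0//.
  by have := ler0n R n; lra.
by rewrite -[e]invrK ltf_pV2 ?posrE ?invr_gt0// (lt_trans _ big)// invr_gt0.
Qed.

Lemma cusps_orbit_limit x : cusps x -> orbit_limit x.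
Proof.
move=> [k [w ->]]; rewrite addrC; apply: orbit_limit_shift.
elim: w => [|l w IH] /=; first exact: orbit_limit0.
have [j _ e] := digit_int R l.
apply: orbit_limit_inv; last first.
  by apply: digit_add_neq0; apply: cfrac_norm1; rewrite normr0.
by rewrite e addrC; exact: orbit_limit_shift.
Qed.

Lemma closure_cusps_limit_set x : closure (@cusps R) x -> limit_set 3 (Some x%:C).
Proof.
move=> /closure_ballP h.
have {}h : orbit_limit x.
  move=> e e0; have e20 : 0 < e / 2 by rewrite divr_gt0.
  have [y /cusps_orbit_limit cy xy] := h _ e20; have [g hg gy] := cy _ e20.
  exists g => //; rewrite (_ : _ - _ = (val (g base_point) - y%:C) + (y - x)%:C).
    by apply: le_lt_trans (le_normcD _ _) _; rewrite normc_real distrC; lra.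
  by rewrite rmorphB addrA subrK.
exists base_point => // U /nbhs_ballP[e /= e0 eU].
have [g hg gx] := h _ (divr_gt0 e0 (ltr0Sn _ 1)).
exists (Some (val (g base_point))); split.
- apply/eqP => -[gE].
  by have := valP (g base_point); rewrite /= gE /= ltxx.
- by exists g.
- apply: eU; rewrite ballEmdist /=.
  apply: le_lt_trans (chordal_le _ _) _.
  by rewrite -normcN opprB; lra.
Qed.

End CuspsAreLimits.

(** * Finite covers of a set with separated copies of itself *)

Section FiniteCovers.
Variables (R : realType) (I : eqType).
Implicit Types (K : set R) (W : seq I) (psi : I -> R -> R) (r : I -> R) (g s : R).

(** Induction on the number of sets of the cover: as long as all of them are
    shorter than the gap [g], they split into covers of the pieces [psi i @` K],
    each with fewer sets, and pulling these back by [psi i] multiplies diameters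
    by at most [(r i)^-1]. *)
Lemma finite_cover_cost K W psi r g s :
  K !=set0 -> uniq W -> 0 <= s -> 0 <= g ->
  (forall i, i \in W -> exists2 j, j \in W & j != i) ->
  (forall i, i \in W -> 0 < r i) ->
  (forall i x, i \in W -> K x -> K (psi i x)) ->
  (forall i x y, i \in W -> K x -> K y -> r i * `|x - y| <= `|psi i x - psi i y|) ->
  (forall i j x y, i \in W -> j \in W -> i != j -> K x -> K y ->
    g <= `|psi i x - psi j y|) ->
  1 <= \sum_(i <- W) r i `^ s ->
  forall (J : seq nat) (A : nat -> set R) (d : nat -> R),
  (forall x, K x -> exists2 j, j \in J & A j x) ->
  (forall j, 0 <= d j) ->
  (forall j x y, K x -> K y -> A j x -> A j y -> `|x - y| <= d j) ->
  g `^ s <= \sum_(j <- J) d j `^ s.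
Proof.
move=> [x0 Kx0] uW s0 g0 W2 r0 psiK expand gap rs J.
have [n] := ubnP (size J); elim: n J => // n IH J; rewrite ltnS => Jn A d cov d0 hd.
have [[j jJ gj]|small] := pselect (exists2 j, j \in J & g <= d j).
  rewrite (big_rem j)//=; apply: le_trans (_ : d j `^ s <= _).
    by apply: ge0_ler_powR; rewrite ?nnegrE.
  by rewrite lerDl sumr_ge0// => k _; exact: powR_ge0.
have {}small j : j \in J -> d j < g.
  by move=> jJ; rewrite ltNge; apply/negP => gj; apply: small; exists j.
pose meets i j : bool := `[< exists2 x, K x & A j (psi i x) >].
have meetsP i j : i \in W -> j \in J -> meets i j ->
    forall i', i' \in W -> i' != i -> ~~ meets i' j.
  move=> iW jJ /asboolP[x Kx Ax] i' i'W ii'; apply/negP => /asboolP[y Ky Ay].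
  have := gap i' i y x i'W iW ii' Ky Kx.
  rewrite leNgt => /negP; apply; apply: le_lt_trans (small j jJ).
  by apply: hd => //; exact: psiK.
have piece i : i \in W -> r i `^ s * g `^ s <= \sum_(j <- J | meets i j) d j `^ s.
  move=> iW.
  have lt_size : (size [seq j <- J | meets i j] < n)%N.
    apply: leq_trans Jn; have [i' i'W ii'] := W2 i iW.
    have [j jJ Aj] := cov _ (psiK i' x0 i'W Kx0).
    have mj : meets i' j by apply/asboolP; exists x0.
    rewrite size_filter -(count_predC (meets i) J) -[ltnLHS]addn0 ltn_add2l -has_count.
    apply/hasP; exists j => //=; apply: (meetsP i' j) => //.
    by rewrite eq_sym.
  (* The pieces of the cover that meet [psi i @` K], pulled back by [psi i]. *)
  have := IH _ lt_size (fun j => psi i @^-1` A j) (fun j => d j / r i).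
  have ri := r0 i iW.
  rewrite big_filter; have -> : \sum_(j <- J | meets i j) (d j / r i) `^ s =
      (\sum_(j <- J | meets i j) d j `^ s) / r i `^ s.
    rewrite mulr_suml; apply: eq_bigr => j _.
    by rewrite powRM ?invr_ge0 ?(ltW ri)// -powR_inv1 ?(ltW ri)// -powRrM mulN1r powRN.
  rewrite ler_pdivlMr ?powR_gt0// [g `^ s * _]mulrC; apply.
  - move=> x Kx; have [j jJ Aj] := cov _ (psiK i x iW Kx).
    by exists j => //; rewrite mem_filter jJ andbT; apply/asboolP; exists x.
  - by move=> j; rewrite divr_ge0// ltW.
  - move=> j x y Kx Ky Ax Ay; rewrite ler_pdivlMr// mulrC.
    by apply: le_trans (expand i x y iW Kx Ky) _; apply: hd => //; exact: psiK.
apply: (@le_trans _ _ (\sum_(i <- W) \sum_(j <- J | meets i j) d j `^ s)).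
  apply: (@le_trans _ _ (\sum_(i <- W) r i `^ s * g `^ s)).
    by rewrite -mulr_suml -[leLHS]mul1r ler_wpM2r ?powR_ge0.
  by rewrite big_seq [leRHS]big_seq; apply: ler_sum.
under eq_bigr do rewrite big_mkcond.
rewrite exchange_big/= big_seq [leRHS]big_seq; apply: ler_sum => j jJ.
have [[i iW mi]|none] := pselect (exists2 i, i \in W & meets i j); last first.
  rewrite big_seq big1 ?powR_ge0// => i iW; case: ifPn => // mi.
  by exfalso; apply: none; exists i.
rewrite (big_rem i)//= mi big_seq big1 ?addr0// => i' i'W.
have ii' : i' != i by apply/eqP => e; move: i'W; rewrite e mem_rem_uniqF.
by rewrite (negbTE (meetsP i j iW jJ mi i' (mem_rem i'W) ii')).
Qed.

End FiniteCovers.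

(** * The finite systems of words of a given length *)

Section WordSystem.
Variable R : realType.
Implicit Types (x y : R) (w : seq letter).

Lemma digit_norm_le N l : (l.2 < N)%N -> `|digit R l| <= 3 * N%:R.
Proof.
move=> lN; rewrite /digit; case: ifP => _; rewrite ?normrN ger0_norm ?mulr_ge0//;
  by rewrite ler_pM2l// ler_nat.
Qed.

Lemma branch_gap N l l' x y : (l.2 < N)%N -> (l'.2 < N)%N -> `|x| <= 2 / 5 ->
  `|y| <= 2 / 5 -> `|digit R l + x - (digit R l' + y)| / (3 * N%:R + 1) ^+ 2 <=
  `|branch l x - branch l' y|.
Proof.
move=> lN l'N x25 y25.
have nx : digit R l + x != 0 by apply: digit_add_neq0; lra.
have ny : digit R l' + y != 0 by apply: digit_add_neq0; lra.
have bd (k : letter) (z : R) : (k.2 < N)%N -> `|z| <= 2 / 5 ->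
    `|digit R k + z| <= 3 * N%:R + 1.
  move=> kN z25; apply: le_trans (ler_normD _ _) _.
  by have := digit_norm_le kN; lra.
rewrite (_ : branch l x - _ = (digit R l + x - (digit R l' + y)) /
  ((digit R l + x) * (digit R l' + y))); last first.
  by rewrite /branch; field; rewrite nx ny.
rewrite normf_div ler_wpM2l// lef_pV2 ?posrE ?normr_gt0 ?mulf_neq0//.
by rewrite normrM expr2 ler_pM ?bd.
Qed.

Lemma digit_gap l l' : l != l' -> 3 <= `|digit R l - digit R l'|.
Proof.
pose z (k : letter) : int := if k.1 then - (k.2.+1)%:Z else (k.2.+1)%:Z.
have zE k : digit R k = 3 * (z k)%:~R.
  by rewrite /digit /z; case: ifP => _; rewrite ?mulrNz ?mulrN.
move=> ll'; rewrite !zE -mulrBr normrM (ger0_norm (_ : 0 <= 3))// ler_peMr//.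
rewrite -intrB -intr_norm -[1]/(1%:~R) ler_int.
have : z l != z l'.
  apply: contra ll'; rewrite /z; case: l l' => -[] n [[] n'] /= /eqP h;
    apply/eqP; congr (_, _); lia.
by lia.
Qed.

(** Distinct words are separated at the first letter in which they differ; each
    common letter before it contracts the gap by a bounded factor. *)
Lemma cfrac_gap N m w w' x y : w \in words N m -> w' \in words N m -> w != w' ->
  `|x| <= 2 / 5 -> `|y| <= 2 / 5 ->
  ((3 * N%:R + 1) ^+ 2)^-1 ^+ m <= `|cfrac w x - cfrac w' y|.
Proof.
have D1 : 1 <= (3 * N%:R + 1) ^+ 2 :> R.
  by rewrite exprn_ege1// lerDr mulr_ge0.
have D0 : 0 < (3 * N%:R + 1) ^+ 2 :> R by apply: lt_le_trans D1.
rewrite !mem_words => + + + x25 y25.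
elim: m w w' => [|m IH] [|l w] [|l' w'] //= /andP[sw /andP[lN aw]]
  /andP[sw' /andP[l'N aw']] ww'.
have cx := cfrac_norm w x25; have cy := cfrac_norm w' y25.
apply: le_trans (branch_gap lN l'N cx cy).
rewrite exprSr ler_wpM2r ?invr_ge0 ?(ltW D0)//.
have [ll'|/digit_gap h] := eqVneq l l'.
  rewrite ll' opprD addrACA subrr add0r; apply: IH; rewrite ?aw ?aw' ?andbT//.
  by apply: contra ww' => /eqP ->; rewrite ll'.
apply: (@le_trans _ _ 1); first by rewrite exprn_ile1 ?invr_ge0 ?invf_le1// ltW.
have := lerB_dist (digit R l - digit R l') (cfrac w' y - cfrac w x).
rewrite (_ : _ - (_ - _) = digit R l + cfrac w x - (digit R l' + cfrac w' y)); last by ring.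
have := ler_normB (cfrac w' y) (cfrac w x).
by lra.
Qed.

End WordSystem.

Section LowerBound.
Variable R : realType.
Implicit Types (x y : R) (w : seq letter).

Let s : R := (3 / 2 + 3 / 2000) / 2.

Lemma lower_dim_gt0 : 0 < s.
Proof. by rewrite /s; lra. Qed.

(** A lower bound of the derivative of [cfrac w] on [-2/5, 2/5]; the factor 49/25 is
    the square of the distortion constant 7/5. *)
Definition expansion_rate w : R := (49 / 25 * `|denom w (0 : R)| ^+ 2)^-1.

Lemma denom0_gt0 w : 0 < `|denom w (0 : R)|.
Proof. by apply: denom_gt0; exact: norm0_le. Qed.

Lemma expansion_rate_gt0 w : 0 < expansion_rate w.
Proof.
have d0 := denom0_gt0 w.
by rewrite invr_gt0 mulr_gt0 ?exprn_gt0//; lra.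
Qed.

Lemma powRV (a t : R) : 0 <= a -> a^-1 `^ t = (a `^ t)^-1.
Proof. by move=> a0; rewrite -powR_inv1// -powRrM mulN1r powRN. Qed.

Lemma expr_unbounded (rho B : R) : 1 < rho -> exists m : nat, B <= rho ^+ m.
Proof.
move=> r1; have r0 : 0 < rho - 1 by rewrite subr_gt0.
have bern (m : nat) : 1 + m%:R * (rho - 1) <= rho ^+ m.
  elim: m => [|m IH]; first by rewrite mul0r addr0.
  have rho0 : 0 <= rho by lra.
  have h := ler_wpM2l rho0 IH; rewrite exprS; apply: le_trans h.
  have m0 : 0 <= m%:R * (rho - 1) ^+ 2 by rewrite mulr_ge0 ?sqr_ge0.
  rewrite -subr_ge0 (_ : _ - _ = m%:R * (rho - 1) ^+ 2)//.
  by rewrite -natr1; ring.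
exists (Num.truncn (B / (rho - 1))).+1; apply: le_trans (bern _).
have h : B / (rho - 1) < (Num.truncn (B / (rho - 1))).+1%:R by exact: truncnS_gt.
by move: h; rewrite ltr_pdivrMr// => /ltW h; apply: le_trans h _; rewrite lerDr.
Qed.

(** The word sums grow like [(1001 / 1000) ^+ m], which eventually exceeds the
    constant lost by passing from the derivatives at 0 to lower bounds on the
    whole core. *)
Lemma expansion_rates_sum : exists N m,
  1 <= \sum_(w <- words N.+1 m.+1) expansion_rate w `^ s.
Proof.
have [N hN] := transfer_expands R; exists N.
set p : R := 3 / 2 + 3 / 2000 in hN.
have rho1 : 1 < 1001 / 1000 :> R by lra.
have C0 : 0 < (49 / 25 : R) `^ s by apply: powR_gt0; lra.
have [m hm] := expr_unbounded (2 * (49 / 25) `^ s) rho1; exists m.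
have rho0 : 0 <= 1001 / 1000 :> R by lra.
have h := word_sum_ge m.+1 rho0 hN (norm0_le R).
have hf w : parabola (17 / 200) (cfrac w 0) <= 2 :> R.
  have := cfrac_norm w (norm0_le R); rewrite /parabola.
  rewrite -(real_normK (num_real (cfrac w 0))) => hc.
  have h2 : `|cfrac w 0| ^+ 2 <= 1 ^+ 2 :> R.
    by rewrite lerXn2r ?nnegrE//; lra.
  by move: h2; rewrite expr1n; lra.
have rateE w : expansion_rate w `^ s = ((49 / 25) `^ s)^-1 * `|denom w (0 : R)| `^ (- p).
  have d0 := denom0_gt0 w.
  have q0 : 0 < 49 / 25 * `|denom w (0 : R)| ^+ 2.
    by rewrite mulr_gt0 ?exprn_gt0//; lra.
  have a0 : 0 <= 49 / 25 :> R by lra.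
  rewrite /expansion_rate powRV ?(ltW q0)// powRM ?exprn_ge0// invfM; congr (_ * _).
  rewrite -powR_mulrn// -powRrM -powRN; congr (_ `^ _).
  by rewrite /s /p; field.
under eq_bigr do rewrite rateE.
rewrite -mulr_sumr ler_pdivlMl// mulr1.
set S := \sum_(_ <- _) _.
have hS : word_sum p (parabola (17 / 200)) N.+1 m.+1 0 <= 2 * S.
  rewrite /word_sum /S mulr_sumr; apply: ler_sum => w _.
  by rewrite mulrC ler_wpM2r ?powR_ge0.
have f0 : parabola (17 / 200) 0 = 1 :> R by rewrite /parabola expr0n mulr0 addr0.
rewrite f0 mulr1 exprS in h.
have r0 : 0 <= (1001 / 1000 : R) ^+ m by rewrite exprn_ge0.
have := ler_wpM2r r0 (ltW rho1).
by rewrite mul1r; lra.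
Qed.

Lemma core_finite_cover_cost : exists2 c : R, 0 < c &
  forall (J : seq nat) (A : nat -> set R) (d : nat -> R),
  (forall x, core x -> exists2 j, j \in J & A j x) ->
  (forall j, 0 <= d j) ->
  (forall j x y, core x -> core y -> A j x -> A j y -> `|x - y| <= d j) ->
  c <= \sum_(j <- J) d j `^ s.
Proof.
have [N [m hsum]] := expansion_rates_sum.
pose g : R := ((3 * N.+1%:R + 1) ^+ 2)^-1 ^+ m.+1.
have D0 : 0 < 3 * N.+1%:R + 1 :> R by rewrite ltr_wpDl// mulr_ge0.
have g0 : 0 < g by rewrite exprn_gt0// invr_gt0 exprn_gt0.
exists (g `^ s); first exact: powR_gt0.
apply: (@finite_cover_cost R _ (@core R) (words N.+1 m.+1) (@cfrac R) expansion_rate) => //.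
- by exists 0; exact: core0.
- exact: words_uniq.
- exact: ltW lower_dim_gt0.
- exact: ltW.
- move=> w; have wl (b : bool) : nseq m.+1 (b, 0) \in words N.+1 m.+1.
    by rewrite mem_words size_nseq eqxx all_nseq orbT.
  move=> _; have [wt|wt] := eqVneq w (nseq m.+1 (true, 0)).
    by exists (nseq m.+1 (false, 0)) => //; rewrite wt.
  by exists (nseq m.+1 (true, 0)) => //; rewrite eq_sym.
- by move=> w _; exact: expansion_rate_gt0.
- by move=> w x _; exact: core_cfrac.
- move=> w x y _ [_ /= x25] [_ /= y25]; rewrite mulrC.
  exact: cfrac_expansion.
- move=> w w' x y hw hw' ww' [_ /= x25] [_ /= y25].
  exact: cfrac_gap hw hw' ww' x25 y25.
Qed.

Lemma core_compact : compact (@core R).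
Proof.
apply: (subclosed_compact _ (@segment_compact R (- (2 / 5)) (2 / 5))).
- apply: closedI; first exact: closed_closure.
  rewrite (_ : [set x | _] = [set` `[- (2 / 5) : R, 2 / 5]]); first exact: itv_closed.
  by apply/seteqP; split => x /=; rewrite in_itv/= ler_norml.
- by move=> x [_ /=]; rewrite in_itv/= ler_norml.
Qed.

End LowerBound.

(** * The Hausdorff measure below the dimension *)

Section Diameter.
Local Open Scope ereal_scope.
Variables (R : realType) (T : metricType R).
Implicit Types (A : set T) (r t : R).

Lemma diameter_ge0 A : 0 <= diameter A.
Proof. by apply: ereal_sup_ubound; left. Qed.

Lemma mdist_le_diameter A p q : A p -> A q -> (mdist p q)%:E <= diameter A.
Proof. by move=> Ap Aq; apply: ereal_sup_ubound; right; exists (p, q). Qed.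

Lemma diameter_le A r : (0 <= r)%R ->
  (forall p q, A p -> A q -> (mdist p q <= r)%R) -> diameter A <= r%:E.
Proof.
move=> r0 h; apply: ge_ereal_sup => _ [->|[[p q] [Ap Aq] <-]]; first by rewrite lee_fin.
by rewrite lee_fin; exact: h.
Qed.

Lemma diameter_pow_ge0 t A : 0 <= diameter_pow t A.
Proof. by rewrite /diameter_pow; case: ifP => // _; exact: poweR_ge0. Qed.

Lemma hausdorff_null_cover t A (eps eta : R) : hausdorff_measure t A = 0 ->
  (0 < eps)%R -> (0 < eta)%R -> exists U : nat -> set T,
  [/\ A `<=` \bigcup_i U i, forall i, diameter (U i) <= eps%:E &
      \sum_(0 <= i <oo) diameter_pow t (U i) < eta%:E].
Proof.
move=> h0 e0 n0.
have : hausdorff_premeasure t eps A < eta%:E.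
  apply: (@le_lt_trans _ _ 0); last by rewrite lte_fin.
  by rewrite -h0; apply: ereal_sup_ubound; exists eps.
move=> /ereal_inf_lt[_ [U [AU dU] <-] hU].
by exists U.
Qed.

End Diameter.

Lemma ler_sum_sub (R : realType) (I : eqType) (r1 r2 : seq I) (F : I -> R) :
  uniq r1 -> {subset r1 <= r2} -> (forall i, 0 <= F i) ->
  \sum_(i <- r1) F i <= \sum_(i <- r2) F i.
Proof.
move=> + + F0; elim: r1 r2 => [|a r1 IH] r2 /=; first by rewrite big_nil sumr_ge0.
move=> /andP[ar1 u1] sub.
have ar2 : a \in r2 by apply: sub; rewrite mem_head.
rewrite big_cons (big_rem a ar2)/= lerD2l; apply: IH => // i ir1.
apply: rem_mem; last by apply: sub; rewrite inE ir1 orbT.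
by apply: contraNneq ar1 => <-.
Qed.

Section LowerTheorem.
Variable R : realType.

Let s : R := (3 / 2 + 3 / 2000) / 2.

(** A countable cover is first enlarged to an open one at an arbitrarily small
    cost, and compactness of [core] then leaves a finite cover. *)
Lemma hausdorff_measure_limit_set_neq0 (t : R) : 0 <= t -> t < s ->
  hausdorff_measure t (limit_set (3 : R)) <> 0%E.
Proof.
move=> t0 ts h0.
have s0 : 0 < s := lower_dim_gt0 R.
have [c c0 hc] := core_finite_cover_cost R.
(* The factor 8 leaves room for the enlargement: the final cost is below 4 eta. *)
pose eta : R := c / 8.
have eta0 : 0 < eta by rewrite divr_gt0.
have [U [cU dU sumU]] := hausdorff_null_cover h0 ltr01 eta0.
pose d i := fine (diameter (U i)).
have dE i : diameter (U i) = (d i)%:E.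
  rewrite /d fineK// ge0_fin_numE ?diameter_ge0//.
  by apply: le_lt_trans (dU i) _; exact: ltry.
have d0 i : 0 <= d i by rewrite -lee_fin -dE diameter_ge0.
have d1 i : d i <= 1 by rewrite -lee_fin -dE.
have dpow i : ((d i `^ s)%:E <= diameter_pow t (U i))%E.
  rewrite /diameter_pow; case: ifPn => [/asboolP U0|_].
    have -> : d i = 0.
      apply/eqP; rewrite eq_le d0 andbT -lee_fin -dE.
      by apply: diameter_le => // p q; rewrite U0.
    by rewrite powR0 ?gt_eqF.
  rewrite dE poweR_EFin lee_fin.
  have [->|dn0] := eqVneq (d i) 0; first by rewrite powR0 ?gt_eqF// powR_ge0.
  by apply: ger_powR (ltW ts); rewrite d1 andbT lt_neqAle eq_sym dn0 d0.
have sum_d M : \sum_(0 <= i < M) d i `^ s <= eta.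
  rewrite -lee_fin; apply: le_trans (ltW sumU).
  rewrite -sumEFin; apply: le_trans (lee_sum _ (fun i _ => dpow i)) _.
  by apply: nneseries_lim_ge => i _ _; exact: diameter_pow_ge0.
pose e (i : nat) : R := (eta / 2 ^+ i.+1) `^ s^-1.
have e0 i : 0 < e i by rewrite powR_gt0// divr_gt0// exprn_gt0.
have es i : e i `^ s = eta / 2 ^+ i.+1.
  rewrite /e -powRrM mulVf ?gt_eqF// powRr1// ltW// divr_gt0// exprn_gt0//.
have sum_e M : \sum_(0 <= i < M) e i `^ s <= eta.
  under eq_bigr do rewrite es.
  suff -> : \sum_(0 <= i < M) eta / 2 ^+ i.+1 = eta - eta / 2 ^+ M.
    by rewrite gerBl divr_ge0 ?exprn_ge0// ltW.
  elim: M => [|M IH]; first by rewrite big_nil expr0 divr1 subrr.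
  rewrite big_nat_recr//= IH exprS; field.
  by rewrite expf_neq0.
pose A i : set R := [set x | `|x| <= 2 / 5 /\ U i (Some x%:C)].
pose O i : set R := \bigcup_(x in A i) ball x (e i / 2).
have oO i : open (O i) by apply: bigcup_open => x _; exact: ball_open.
have Od i x y : O i x -> O i y -> `|x - y| <= d i + e i.
  move=> [x' [x'25 Ux'] xx'] [y' [y'25 Uy'] yy'].
  have hd : `|x' - y'| <= d i.
    apply: le_trans (chordal_real_ge x'25 y'25) _.
    by rewrite -lee_fin -dE; exact: (mdist_le_diameter Ux' Uy').
  have t1 := ler_distD x' x y; have t2 := ler_distD y' x' y.
  move: xx' yy'; rewrite /ball/= (distrC x' x) => xx' yy'.
  by lra.
have : cover_compact (@core R) by rewrite -compact_cover; exact: core_compact.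
move=> /(_ nat setT O (fun i _ => oO i)).
have cov : @core R `<=` cover setT O.
  move=> x [cx /= x25].
  have [i _ Ux] := cU _ (closure_cusps_limit_set cx).
  by exists i => //; exists x; [split|apply: ballxx; rewrite divr_gt0].
move=> /(_ cov)[D _ cD].
have : c <= \sum_(i <- finmap.enum_fset D) (d i + e i) `^ s.
  apply: (hc _ O).
  - by move=> x /cD[i /= iD Oi]; exists i.
  - by move=> j; rewrite addr_ge0 ?d0 ?ltW.
  - by move=> j x y _ _; exact: Od.
apply/negP; rewrite -ltNge.
pose M := (\max_(i <- finmap.enum_fset D) i).+1.
have sub i : i \in finmap.enum_fset D -> i \in index_iota 0 M.
  by move=> iD; rewrite mem_index_iota /= ltnS leq_bigmax_seq.
(* Both summands are compared with the larger one; the exponent is below 1. *)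
have pw i : (d i + e i) `^ s <= 2 * (d i `^ s + e i `^ s).
  have s1 : s <= 1 by rewrite /s; lra.
  pose m := Num.max (d i) (e i).
  have m0 : 0 <= m by rewrite le_max d0.
  have dm : d i <= m by rewrite le_max lexx.
  have em : e i <= m by rewrite le_max lexx orbT.
  apply: (@le_trans _ _ ((2 * m) `^ s)).
    apply: ge0_ler_powR; rewrite ?nnegrE ?(ltW s0) ?addr_ge0 ?mulr_ge0 ?(ltW (e0 i))//.
    by lra.
  rewrite powRM// ler_pM ?powR_ge0//; first by apply: ler1_powR => //; lra.
  by rewrite /m /Num.max; case: ifP => _; rewrite ?lerDl ?lerDr powR_ge0.
apply: (@le_lt_trans _ _ (\sum_(0 <= i < M) (d i + e i) `^ s)).
  apply: ler_sum_sub => [|i|i]; first exact: finmap.fset_uniq.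
    exact: sub.
  exact: powR_ge0.
apply: (@le_lt_trans _ _ (2 * (eta + eta))).
  apply: le_trans (ler_sum _ (fun i _ => pw i)) _.
  by rewrite -mulr_sumr big_split/= ler_wpM2l// lerD.
by rewrite /eta; lra.
Qed.

End LowerTheorem.

(** * The Hausdorff measure above the dimension *)

(** A set is null as soon as it has countable covers of arbitrarily small cost:
    a small cost also bounds each diameter. *)
Lemma hausdorff_measure_eq0 (R : realType) (T : metricType R) (s : R) (A : set T) :
  0 < s ->
  (forall eta : R, 0 < eta -> exists (I : countType) (U : I -> set T) (g : I -> R),
    [/\ A `<=` \bigcup_i U i, forall i, 0 <= g i,
        forall i p q, U i p -> U i q -> mdist p q `^ s <= g i &
        forall F : seq I, uniq F -> \sum_(i <- F) g i <= eta]) ->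
  hausdorff_measure s A = 0%E.
Proof.
move=> s0 small.
have pre_le (eps eta : R) : 0 < eps -> 0 < eta ->
    (hausdorff_premeasure s eps A <= eta%:E)%E.
  move=> e0 n0.
  have m0 : 0 < Num.min eta (eps `^ s) by rewrite lt_min n0 powR_gt0.
  have [I [U [g [AU g0 hU sumg]]]] := small _ m0.
  have gle i : g i <= Num.min eta (eps `^ s).
    by have := sumg [:: i] isT; rewrite big_seq1.
  have diamU i : (diameter (U i) <= (g i `^ s^-1)%:E)%E.
    apply: diameter_le => [|p q Up Uq]; first exact: powR_ge0.
    have := hU i p q Up Uq => h.
    rewrite -[leLHS]powRr1 ?mdist_ge0// -(mulfV (lt0r_neq0 s0)) powRrM.
    by apply: ge0_ler_powR; rewrite ?nnegrE ?powR_ge0// invr_ge0 ltW.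
  have gs i : (g i `^ s^-1) `^ s = g i.
    by rewrite -powRrM mulVf ?gt_eqF// powRr1.
  (* The cover is indexed by natural numbers through the sharp inverse of the
     encoding of [I], so that no set is repeated. *)
  pose V n : set T := if pickle_inv n is Some i then U i else set0.
  pose h n : R := if pickle_inv n is Some i then g i else 0.
  have h0 n : 0 <= h n by rewrite /h; case: pickle_inv.
  have diam0 : diameter (set0 : set T) = 0%E.
    by apply/eqP; rewrite eq_le diameter_ge0 andbT; apply: diameter_le.
  have powV n : (diameter_pow s (V n) <= (h n)%:E)%E.
    rewrite /diameter_pow /V /h; case: pickle_inv => [i|]; last first.
      by case: ifPn => // /asboolP[].
    case: ifPn => [_|_]; first by rewrite lee_fin.
    rewrite -[in leRHS](gs i) -poweR_EFin.
    apply: gt0_ler_poweR; rewrite ?(ltW s0) ?in_itv/= ?diameter_ge0 ?leey ?lee_fin ?powR_ge0//.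
  apply: (@le_trans _ _ (\sum_(0 <= n <oo) diameter_pow s (V n))%E).
    apply: ereal_inf_lbound; exists V => //; split.
      move=> x /AU[i _ Ux]; exists (pickle i) => //.
      by rewrite /V pickleK_inv.
    move=> n; rewrite /V; case: pickle_inv => [i|]; last by rewrite diam0 lee_fin ltW.
    apply: le_trans (diamU i) _; rewrite lee_fin.
    rewrite -[leRHS]powRr1 ?(ltW e0)// -(mulfV (lt0r_neq0 s0)) powRrM.
    apply: ge0_ler_powR; rewrite ?nnegrE ?powR_ge0// ?invr_ge0 ?(ltW s0)//.
    by apply: le_trans (gle i) _; rewrite ge_min lexx orbT.
  apply: lime_le; first by apply: is_cvg_nneseries => n _ _; exact: diameter_pow_ge0.
  apply: nearW => N; apply: le_trans (lee_sum _ (fun n _ => powV n)) _.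
  rewrite sumEFin lee_fin.
  have -> : \sum_(0 <= n < N) h n = \sum_(i <- pmap (@pickle_inv I) (index_iota 0 N)) g i.
    elim: (index_iota 0 N) => [|n r IH]; first by rewrite !big_nil.
    rewrite big_cons /= /h; case: pickle_inv => [i|] /=; last by rewrite add0r.
    by rewrite big_cons IH.
  apply: (@le_trans _ _ (Num.min eta (eps `^ s))); last by rewrite ge_min lexx.
  by apply: sumg; apply: (pmap_uniq (@pickle_invK I)); exact: iota_uniq.
have pre_ge eps : (0 <= hausdorff_premeasure s eps A)%E.
  apply: le_ereal_inf_tmp => _ [U _ <-].
  by apply: nneseries_ge0 => n _ _; exact: diameter_pow_ge0.
apply/eqP; rewrite eq_le; apply/andP; split.
  apply: ge_ereal_sup => _ [eps /= e0 <-].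
  by apply/lee_addgt0Pr => eta n0; rewrite add0e; exact: pre_le.
apply: le_trans (pre_ge 1) _; apply: ereal_sup_ubound.
by exists 1 => //=; exact: ltr01.
Qed.

Section UpperTheorem.
Variable R : realType.

Let s : R := (3 / 2 + 4 / 625) / 2.

Let sphere_point (b : bool) : R -> riemann_sphere R :=
  if b then @inv_point R else fun x => Some x%:C.

Let sphere_point_lipschitz b (x y : R) :
  chordal (sphere_point b x) (sphere_point b y) <= 2 * `|x - y|.
Proof.
case: b; first exact: chordal_inv_point.
by apply: le_trans (chordal_le _ _) _; rewrite -rmorphB normc_real.
Qed.

Let limit_set_core p : limit_set (3 : R) p ->
  exists b x, core x /\ p = sphere_point b x.
Proof.
move=> /limit_set_sub[->|[x cx ->]].
  by exists true, 0; split; [exact: core0|rewrite /sphere_point/= /inv_point eqxx].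
have [cx'|[x0 cx']] := closure_cusps_core cx; first by exists false, x.
exists true, (- x^-1); split => //.
by rewrite /sphere_point/= /inv_point oppr_eq0 invr_eq0 (negbTE x0) invrN invrK opprK.
Qed.

Lemma expr_vanishes (rho B eta : R) : 0 < rho -> rho < 1 -> 0 < B -> 0 < eta ->
  exists m : nat, B * rho ^+ m <= eta.
Proof.
move=> r0 r1 B0 n0; have [m hm] := @expr_unbounded R rho^-1 (B / eta) ltac:(by rewrite invf_gt1).
exists m; move: hm; rewrite exprVn ler_pdivrMr// mulrC.
by rewrite ler_pdivlMr ?exprn_gt0.
Qed.

(** The pieces [cfrac w @` core] with [size w = m] cover the core up to countably
    many points, the values at 0 of the shorter words; together with their images under the inversion
    they cover the limit set. *)
Lemma hausdorff_measure_limit_set_eq0 : hausdorff_measure s (limit_set (3 : R)) = 0%E.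
Proof.
have s0 : 0 < s by rewrite /s; lra.
apply: hausdorff_measure_eq0 => // eta n0.
set p : R := 3 / 2 + 4 / 625.
have sp : s *+ 2 = p by rewrite -mulr_natr /s /p; field.
(* 40 / 9 is 2, for the chordal metric, times the length 4 / 5 of the interval,
   divided by the distortion factor 9 / 25. *)
pose C : R := (40 / 9) `^ s.
have C0 : 0 < C by apply: powR_gt0; lra.
have r0 : 0 < 1999 / 2000 :> R by lra.
have r1 : 1999 / 2000 < 1 :> R by lra.
have [m hm] := expr_vanishes r0 r1 (mulr_gt0 (ltr0Sn R 1) C0) n0.
exists (bool * seq letter)%type.
exists (fun i => if size i.2 == m then [set sphere_point i.1 (cfrac i.2 x) | x in @core R]
  else [set sphere_point i.1 (cfrac i.2 0)]).
exists (fun i => if size i.2 == m then C * `|denom i.2 (0 : R)| `^ (- p) else 0).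
split.
- move=> q /limit_set_core[b [x [cx ->]]].
  have [w [[sw ->]|[sw [y cy ->]]]] := core_words m cx.
    by exists (b, w) => //=; rewrite ltn_eqF.
  by exists (b, w) => //=; rewrite sw eqxx; exists y.
- by move=> i; case: ifP => // _; rewrite mulr_ge0 ?powR_ge0// ltW.
- move=> [b w] q q' /=; case: ifP => _; last first.
    by move=> -> ->; rewrite mdistxx powR0// gt_eqF.
  move=> [x [_ /= x25] <-] [y [_ /= y25] <-].
  have c0 : 0 <= 40 / 9 :> R by lra.
  have d0 := denom0_gt0 R w.
  have h : mdist (sphere_point b (cfrac w x)) (sphere_point b (cfrac w y)) <=
      40 / 9 * `|denom w (0 : R)| `^ (- 2).
    rewrite powR_invn ?(ltW d0)//.
    apply: (le_trans (sphere_point_lipschitz b (cfrac w x) (cfrac w y))).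
    have h1 := cfrac_contraction w x25 y25.
    have h2 : `|x - y| <= 4 / 5 by apply: le_trans (ler_normB _ _) _; lra.
    have i0 : 0 <= (9 / 25 * `|denom w (0 : R)| ^+ 2)^-1.
      by rewrite invr_ge0 mulr_ge0 ?exprn_ge0//; lra.
    have h3 := ler_wpM2r i0 h2.
    rewrite (_ : 40 / 9 * _ = 2 * (4 / 5 * (9 / 25 * `|denom w (0 : R)| ^+ 2)^-1)).
      by rewrite ler_wpM2l// (le_trans h1).
    by field; rewrite gt_eqF.
  apply: (@le_trans _ _ ((40 / 9 * `|denom w (0 : R)| `^ (- 2)) `^ s)).
    by apply: (ge0_ler_powR (ltW s0)) => //; rewrite nnegrE ?mdist_ge0 ?mulr_ge0 ?powR_ge0.
  rewrite (powRM _ c0 (powR_ge0 _ _)).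
  by rewrite -powRrM (_ : - 2 * s = - p)//; rewrite -sp -mulr_natr; ring.
- move=> F uF; rewrite -big_mkcond/=.
  (* A bound on the letters of the finitely many words of [F]. *)
  pose N := (\max_(i <- F) \max_(l <- i.2) l.2).+1.
  rewrite -big_filter.
  set G := (fun i : bool * seq letter => C * `|denom i.2 (0 : R)| `^ (- p)).
  apply: (@le_trans _ _ (\sum_(i <- [seq (b, w) | b <- [:: false; true], w <- words N m]) G i)).
    apply: ler_sum_sub; first exact: filter_uniq.
      move=> [b w]; rewrite mem_filter => /andP[sw wF]; rewrite /= in sw.
      apply: (allpairs_f pair); first by case: b wF.
      rewrite mem_words sw/=; apply/allP => l lw; rewrite /N ltnS.
      have h1 : (l.2 <= \max_(l <- w) l.2)%N by exact: leq_bigmax_seq lw isT.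
      apply: leq_trans h1 _.
      by have := @leq_bigmax_seq _ F xpredT (fun i => \max_(l <- i.2) l.2)%N _ wF isT.
    by move=> i; rewrite mulr_ge0 ?powR_ge0// ltW.
  rewrite big_allpairs !big_cons big_nil /= addr0 /G/= -mulr_sumr.
  have h := word_sum_le m (ltW r0) (fun y => @transfer_contracts R N y) (norm0_le R).
  have f0 : parabola (3 / 25) 0 = 1 :> R by rewrite /parabola expr0n mulr0 addr0.
  rewrite f0 mulr1 in h.
  set S := \sum_(_ <- _) _.
  have hS : S <= (1999 / 2000) ^+ m.
    apply: le_trans h; rewrite /word_sum; apply: ler_sum => w _.
    rewrite ler_peMr ?powR_ge0// /parabola lerDl mulr_ge0 ?sqr_ge0//; lra.
  apply: le_trans hm.
  have := ler_wpM2l (ltW C0) hS.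
  by lra.
Qed.

End UpperTheorem.

(** * The bounds on the dimension *)

(* Only the boolean test is evaluated: normalizing the numerals themselves
   would build unary terms of that depth. *)
Lemma numeral_75065 : (75065 = 75 * 1000 + 65)%N.
Proof. by apply/eqP; vm_compute. Qed.

Lemma numeral_75322 : (75322 = 75 * 1000 + 322)%N.
Proof. by apply/eqP; vm_compute. Qed.

Lemma five_digits_lt (R : realType) (a b : nat) (t : R) :
  ((a * 1000 + b)%N%:R / 10 ^+ 5 < t) = (a%:R * 1000 + b%:R < t * 100 * 1000).
Proof.
rewrite natrD natrM ltr_pdivrMr ?exprn_gt0// (_ : 10 ^+ 5 = 100 * 1000) ?mulrA//.
by ring.
Qed.

Lemma five_digits_gt (R : realType) (a b : nat) (t : R) :
  (t < (a * 1000 + b)%N%:R / 10 ^+ 5) = (t * 100 * 1000 < a%:R * 1000 + b%:R).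
Proof.
rewrite natrD natrM ltr_pdivlMr ?exprn_gt0// (_ : 10 ^+ 5 = 100 * 1000) ?mulrA//.
by ring.
Qed.

Local Open Scope ereal_scope.

Theorem mainTheorem6 (R : realType) :
  (75065%:R / 10 ^+ 5)%:E < hecke_delta (3 : R) < (75322%:R / 10 ^+ 5)%:E.
Proof.
apply/andP; split.
  apply: (@lt_le_trans _ _ ((3 / 2 + 3 / 2000) / 2)%:E).
    by rewrite lte_fin numeral_75065 five_digits_lt; clear; lra.
  apply: le_ereal_inf_tmp => _ [t [t0 ht] <-].
  rewrite lee_fin leNgt; apply/negP => ts.
  exact: (hausdorff_measure_limit_set_neq0 t0 ts ht).
apply: (@le_lt_trans _ _ ((3 / 2 + 4 / 625) / 2)%:E).
  apply: ereal_inf_lbound; exists ((3 / 2 + 4 / 625) / 2)%R; last by [].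
  split.
    by clear; lra.
  exact: hausdorff_measure_limit_set_eq0.
by rewrite lte_fin numeral_75322 five_digits_gt; clear; lra.
Qed.
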